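(* Let $1<p\le2$, let $3\le s\le d$ be an integer, and suppose that $T\ge8/(p-1)$. There exists a deterministic sequence of linear losses on $B_p^d=\{x\in\mathbb R^d:\|x\|_p\le1\}$, with gradients in $[-1,1]^d$ supported on a fixed set of $s$ coordinates, such that online mirror descent with mirror map $h_p(x)=\frac{\|x\|_p^2}{2(p-1)}$ and standard step size, started at $x^{(1)}=0$, satisfies $$\mathrm{regret}_{h_p}(T)=\Theta\left(s^{1-1/p}\sqrt{\frac{T}{p-1}}\right).$$ On the same instance, online mirror descent started at $x^{(1)}=0$ with a uniformly random equal-size partition into $s$ blocks, normalized mirror map $h_{\mathcal B,\rho_s(B_p^d)}$, and standard step size satisfies $$\mathbb E[\mathrm{regret}_s(T)]=O\left(s^{1-1/p}\ln s\sqrt T\right).$$ All implicit constants are absolute. In particular, for an absolute constant $c>0$, $$\mathrm{regret}_{h_p}(T)\ \ge\ \frac{c}{\sqrt{p-1}\,\ln s}\ \mathbb E[\mathrm{regret}_s(T)].$$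
   Context: Online mirror descent on a compact convex set $\mathcal K$ with mirror map $h$ and step size $\eta$: $x^{(t+1)}=\arg\min_{x\in\mathcal K}\langle\nabla f^{(t)}(x^{(t)}),x\rangle+\frac1\eta B_h(x\|x^{(t)})$, with $B_h(x\|y)=h(x)-h(y)-\langle\nabla h(y),x-y\rangle$. Its regret is $\sum_{t=1}^Tf^{(t)}(x^{(t)})-\min_{x\in\mathcal K}\sum_{t=1}^Tf^{(t)}(x)$. Standard step size for $h_p$ (which is $1$-strongly convex with respect to $\|\cdot\|_p$): $\eta=D_{h_p}/(G_{h_p}\sqrt T)$ where $D_{h_p}=\sqrt{\max_{x\in B_p^d}B_{h_p}(x\|x^{(1)})}$ and $G_{h_p}=\max_t\sup_{x}\|\nabla f^{(t)}(x)\|_q$, $1/p+1/q=1$. Block norms. $[d]=\{1,\dots,d\}$. For a partition $\mathcal B=\{B_1,\dots,B_n\}$ of $[d]$ into nonempty blocks, $\|x\|_{[\mathcal B]}=\sum_{j}\|x_{B_j}\|_2$ ($x_{B_j}$ is the restriction of $x$ to $B_j$), with dual norm $\|g\|^*_{[\mathcal B]}=\max_j\|g_{B_j}\|_2$. It is equal-size if block sizes differ by at most $1$. For $n\ge3$ put $\gamma_n=\frac1{e\ln n}$, $p_n=1+\frac1{\ln n}$, $h_{\mathcal B}(x)=\frac1{\gamma_np_n}\sum_j\|x_{B_j}\|_2^{p_n}$ and $h_{\mathcal B,\rho}(x)=\rho^2h_{\mathcal B}(x/\rho)$. $\rho_n(\mathcal K)=\max_{\mathcal B}\sup_{x\in\mathcal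 K}\|x\|_{[\mathcal B]}$ over equal-size $n$-partitions. The random partition $\mathcal B$ into $n=s$ blocks is drawn once before the first round, independently of the losses, uniformly among equal-size partitions; the standard step size is $\eta=D_s/(G_s\sqrt T)$ with $D_s=\big(\mathbb E_{\mathcal B}[\max_{z\in\mathcal K}B_{h_{\mathcal B,\rho_s(\mathcal K)}}(z\|x^{(1)})]\big)^{1/2}$ and $G_s=\max_t\big(\mathbb E_{\mathcal B}[\sup_{x\in\mathcal K}(\|\nabla f^{(t)}(x)\|^*_{[\mathcal B]})^2]\big)^{1/2}$, $\mathcal K=B_p^d$. $\mathrm{regret}_s$ is the regret of this algorithm and the expectation is over $\mathcal B$. *)

(* Defs.v *)
From HB Require Import structures.
From mathcomp Require Import all_boot all_order all_algebra.
From mathcomp Require Import all_classical all_reals all_analysis.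

Set Implicit Arguments.
Unset Strict Implicit.
Unset Printing Implicit Defensive.

Import Order.TTheory GRing.Theory Num.Theory.
Import numFieldNormedType.Exports.

Local Open Scope classical_set_scope.
Local Open Scope ring_scope.

(* Rounds are numbered 1, ..., T, so sequences indexed by [nat] are only read
   on that range.  Every [sup] and [inf] below is used on the image of a
   nonempty compact set by a continuous function, where it is a maximum or a
   minimum. *)

Section OnlineMirrorDescent.
Context {R : realType} {d : nat}.
Implicit Types (x y g : 'rV[R]_d) (K : set 'rV[R]_d) (h : 'rV[R]_d -> R).
Implicit Types (f : nat -> 'rV[R]_d -> R) (X : nat -> 'rV[R]_d) (T : nat).

Definition inner g x : R := \sum_i g 0 i * x 0 i.

Definition grad h y : 'rV[R]_d := \row_i 'D_(delta_mx 0 i) h y.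

Definition bregman h x y : R := h x - h y - inner (grad h y) (x - y).

Definition is_argmin K h x : Prop := K x /\ forall y, K y -> h x <= h y.

(* A relation rather than a function: it holds of [X] when X 1, ..., X T are
   iterates of online mirror descent started at [x1]. *)
Definition omd_run K h (eta : R) x1 f T X : Prop :=
  X 1%N = x1 /\
  forall t, (1 <= t < T)%N ->
    is_argmin K
      (fun z => inner (grad (f t) (X t)) z + eta^-1 * bregman h z (X t))
      (X t.+1).

Definition regret K f T X : R :=
  \sum_(1 <= t < T.+1) f t (X t)
  - inf [set \sum_(1 <= t < T.+1) f t z | z in K].

Definition step_size (D G : R) T : R := D / (G * Num.sqrt T%:R).

Definition lpnorm (p : R) x : R := (\sum_i `|x 0 i| `^ p) `^ p^-1.

Definition lpball (p : R) : set 'rV[R]_d := [set x | lpnorm p x <= 1].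

Definition h_lp (p : R) x : R := lpnorm p x ^+ 2 / (2 * (p - 1)).

Definition D_lp (p : R) x1 : R :=
  Num.sqrt (sup [set bregman (h_lp p) z x1 | z in lpball p]).

(* [q] is the exponent conjugate to [p]. *)
Definition G_lp (p q : R) f T : R :=
  \big[Num.max/0]_(1 <= t < T.+1)
    sup [set lpnorm q (grad (f t) z) | z in lpball p].

Definition eta_lp (p q : R) x1 f T : R :=
  step_size (D_lp p x1) (G_lp p q f T) T.

End OnlineMirrorDescent.

Section BlockNorms.
Context {R : realType} {d : nat}.
Implicit Types (x g : 'rV[R]_d) (K : set 'rV[R]_d) (P : {set {set 'I_d}}).
Implicit Types (f : nat -> 'rV[R]_d -> R) (T : nat).

(* [finset.partition] forces the blocks to be nonempty.  The blocks are unlabelled;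
   labelling them would repeat each partition n`! times and give the same
   uniform law. *)
Definition eqparts (n : nat) : {set {set {set 'I_d}}} :=
  [set P : {set {set 'I_d}} |
    [&& finset.partition P [set: 'I_d], #|P| == n &
        [forall A in P, forall B in P, (#|A| <= #|B|.+1)%N]]]%SET.

Definition expect_part (n : nat) (F : {set {set 'I_d}} -> R) : R :=
  (\sum_(P in eqparts n) F P) / #|eqparts n|%:R.

Definition restr_norm2 (A : {set 'I_d}) x : R :=
  Num.sqrt (\sum_(i in A) x 0 i ^+ 2).

Definition block_norm P x : R := \sum_(A in P) restr_norm2 A x.

Definition block_dual_norm P g : R :=
  \big[Num.max/0]_(A in P) restr_norm2 A g.

Definition gamma_ (n : nat) : R := (expR 1 * ln n%:R)^-1.

Definition p_ (n : nat) : R := 1 + (ln n%:R)^-1.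

Definition h_block P x : R :=
  (gamma_ #|P| * p_ #|P|)^-1 * \sum_(A in P) restr_norm2 A x `^ p_ #|P|.

Definition h_block_norm P (rho : R) x : R := rho ^+ 2 * h_block P (rho^-1 *: x).

Definition rho_ (n : nat) K : R :=
  \big[Num.max/0]_(P in eqparts n) sup [set block_norm P x | x in K].

Definition D_block (n : nat) K (x1 : 'rV[R]_d) : R :=
  Num.sqrt (expect_part n (fun P =>
    sup [set bregman (h_block_norm P (rho_ n K)) z x1 | z in K])).

Definition G_block (n : nat) K f T : R :=
  \big[Num.max/0]_(1 <= t < T.+1)
    Num.sqrt (expect_part n (fun P =>
      sup [set block_dual_norm P (grad (f t) z) ^+ 2 | z in K])).

Definition eta_block (n : nat) K (x1 : 'rV[R]_d) f T : R :=
  step_size (D_block n K x1) (G_block n K f T) T.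

End BlockNorms.

Arguments eqparts d n : clear implicits.

(* Main.v *)
Require Import Defs.
From HB Require Import structures.
From mathcomp Require Import all_boot all_order all_algebra.
From mathcomp Require Import all_classical all_reals all_analysis.
From mathcomp Require Import perm ring lra.

Set Implicit Arguments.
Unset Strict Implicit.
Unset Printing Implicit Defensive.

Import Order.TTheory GRing.Theory Num.Theory.
Import numFieldNormedType.Exports.

Local Open Scope classical_set_scope.
Local Open Scope ring_scope.

(** Every round has the same loss [ind_loss S x = - \sum_(i in S) x 0 i], where
    [S] has [s] elements.  Put [N = s `^ (1 - p^-1)].  On the [p]-ball the loss is
    minimised by the point [flat p S] with equal coordinates on [S], where its
    value is [- N].

    For the mirror map [h_lp p] the run can be computed.  By Holder's inequality
    and its equality case, a step from a point [r *: flat p S] has the unique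
    minimiser [Num.min 1 (r + delta) *: flat p S] ([argmin_h_lp]), where the
    standard step size gives [delta = sqrt ((p - 1) / (2 * T))].  The run needs
    [delta^-1] rounds, which is less than [T] since [8 / (p - 1) <= T], to reach the
    minimiser, and until then its regret per round decreases linearly from [N]
    to [0].  The regret is therefore close to [N / (2 * delta)], which has order
    [N * sqrt (T / (p - 1))] ([lp_regret_bounds]).

    For the block mirror maps the iterates have no such form.  As the losses are
    linear and equal, mirror descent is the proximal point method, and convexity
    of the mirror map [h] bounds the regret by [N] plus [eta^-1] times the
    largest value of [bregman h z 0] on the ball ([omd_linear_regret]).  Averaged
    over the partition and with the standard step size this is
    [N + D * G * sqrt T].  Here [D ^+ 2] is at most [N ^+ 2 * (expR 1 * ln s)], because
    a power mean inequality bounds the block norm by [N] on the ball.  Moreover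
    [G ^+ 2] is the mean of the largest number of elements of [S] in one block.
    This mean is of order [ln s] ([expect_max_load_le]): by symmetry under
    permutations of the coordinates and the binomial theorem, the mean of
    [2 ^ #|A :&: S|], added over the blocks [A], is at most [2 * expR 1 * s].

    The first regret is thus at least a constant times
    [(Num.sqrt (p - 1) * ln s)^-1] times the mean of the second. *)

(** * Powers of a real variable *)

(** Bernoulli's inequality with its equality case.  Strictness is what will make
    the mirror descent iterate for [h_lp] unique. *)
Lemma powR_ge_tangent1 (R : realType) (a x : R) : 1 < a -> 0 <= x ->
  1 + a * (x - 1) <= x `^ a ?= iff (x == 1).
Proof.
move=> a1; rewrite le_eqVlt => /orP[/eqP <-|x0].
  rewrite (powR0 (lt0r_neq0 (lt_trans ltr01 a1))) lt_eqF//.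
  have ineq : 1 + a * (0 - 1) < 0 by lra.
  by split; [exact: ltW|rewrite lt_eqF].
have [->|x1] := eqVneq x 1.
  by rewrite subrr mulr0 addr0 powR1; exact/leif_refl.
set w := 1 + a * (x - 1).
suff wx : w < x `^ a by split; [exact: ltW|rewrite lt_eqF].
have [w0|w0] := leP w 0; first by rewrite (le_lt_trans w0)// powR_gt0.
(* [x] is the mean of [w] and [1] with weights [a^-1] and [1 - a^-1]; the
   bound [1 + t <= expR t] at [ln (w / x)] and at [ln (1 / x)] gives
   [ln w < a * ln x]. *)
have lnx0 : - ln x != 0 by rewrite oppr_eq0 ln_eq0.
have := expR_gt1Dx lnx0; rewrite expRN lnK ?posrE// => h1.
have := expR_ge1Dx (ln w - ln x); rewrite expRB !lnK ?posrE// => h2.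
rewrite -(lnK w0) /powR gt_eqF// ltr_expR.
have h2' : (1 + (ln w - ln x)) * x <= w by rewrite -ler_pdivlMr.
have h1' : (1 - ln x) * x < 1 by rewrite -ltr_pdivlMr// div1r.
rewrite -subr_gt0 -(pmulr_rgt0 _ x0).
have : (a - 1) * ((1 - ln x) * x) < (a - 1) * 1 by rewrite ltr_pM2l// subr_gt0.
move: h2'; rewrite /w; nra.
Qed.

(** The tangent inequality at [r], from the one at [1] by homogeneity; at
    [r = 0] the slope is [0] because [a - 1 > 0]. *)
Lemma powR_ge_tangent (R : realType) (a r x : R) : 1 < a -> 0 <= r -> 0 <= x ->
  r `^ a + a * r `^ (a - 1) * (x - r) <= x `^ a.
Proof.
move=> a1; rewrite le_eqVlt => /orP[/eqP <-|r0] x0.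
  have a0 : 0 < a by rewrite (lt_trans _ a1).
  by rewrite !powR0 ?gt_eqF ?subr_gt0// mulr0 mul0r addr0 powR_ge0.
have xr0 : 0 <= x / r by rewrite divr_ge0// ltW.
have [+ _] := powR_ge_tangent1 a1 xr0.
have -> : x `^ a = r `^ a * (x / r) `^ a.
  by rewrite -powRM// ?ltW// mulrC divfK ?gt_eqF.
rewrite -(ler_pM2l (powR_gt0 a r0)).
apply: le_trans; rewrite le_eqVlt; apply/orP; left; apply/eqP.
have -> : r `^ a = r * r `^ (a - 1).
  by rewrite mulr_powRB1 ?ltW ?(lt_trans _ a1).
by field; rewrite gt_eqF.
Qed.

Lemma powR_convex (R : realType) (a t x y : R) :
  1 <= a -> 0 <= t <= 1 -> 0 <= x -> 0 <= y ->
  ((1 - t) * x + t * y) `^ a <= (1 - t) * x `^ a + t * y `^ a.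
Proof.
rewrite le_eqVlt => /orP[/eqP <-|a1] /andP[t0 t1] x0 y0.
  by rewrite !powRr1// addr_ge0// mulr_ge0// subr_ge0.
set m := _ + t * y.
have m0 : 0 <= m by rewrite addr_ge0// mulr_ge0// subr_ge0.
have hx := powR_ge_tangent a1 m0 x0; have hy := powR_ge_tangent a1 m0 y0.
have t1' : 0 <= 1 - t by rewrite subr_ge0.
have {}hx := ler_wpM2l t1' hx; have {}hy := ler_wpM2l t0 hy.
apply: le_trans (lerD hx hy).
rewrite le_eqVlt; apply/orP; left; apply/eqP.
by move: (m `^ a) (m `^ (a - 1)) => u v; rewrite /m; ring.
Qed.

Lemma cvg_norm_powR0 (R : realType) (b : R) : 0 < b ->
  `|t| `^ b @[t --> (0 : R)] --> (0 : R).
Proof.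
move=> b0; apply/cvgr0Pnorm_lt => e e0; near=> t.
rewrite ger0_norm ?powR_ge0//.
have -> : e = (e `^ b^-1) `^ b by rewrite -powRrM mulVf ?gt_eqF// powRr1// ltW.
apply: gt0_ltr_powR; rewrite ?nnegrE ?powR_ge0//.
by near: t; exact: (@nbhs0_lt _ R _ (powR_gt0 _ e0)).
Unshelve. all: by end_near. Qed.

Lemma continuous_norm_powR (R : realType) (b : R) : 0 < b ->
  continuous (fun t : R => `|t| `^ b).
Proof.
move=> b0 x; have [->|x0] := eqVneq x 0.
  by rewrite /continuous_at normr0 powR0 ?gt_eqF//; exact: cvg_norm_powR0.
apply: (@continuous_comp R R R (@Num.norm R R) (fun u => u `^ b)).
  exact: norm_continuous.
apply: differentiable_continuous; apply/derivable1_diffP.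
by apply: derivable_powR; rewrite in_itv/= normr_gt0 x0.
Qed.

(** The powers of the block norms are differentiable at the origin, where the
    norms themselves are not, because the exponent exceeds [1]. *)
Lemma is_derive_norm_powR0 (R : realType) (a : R) : 1 < a ->
  is_derive (0 : R) (1 : R) (fun t : R => `|t| `^ a) 0.
Proof.
move=> a1; have a0 : 0 < a by rewrite (lt_trans _ a1).
suff c : t^-1 *: ((fun t : R => `|t| `^ a) (t *: 1 + 0) - `|0 : R| `^ a)
    @[t --> 0^'] --> (0 : R).
  by apply: DeriveDef; [exact: cvgP c|exact: cvg_lim c].
apply/norm_cvg0P.
apply: (@cvg_trans _ (`|t| `^ (a - 1) @[t --> (0 : R)^'])); last first.
  have a10 : 0 < a - 1 by rewrite subr_gt0.
  apply: cvg_trans (cvg_norm_powR0 a10).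
  exact: (cvg_app _ (@cvg_within _ _ _ _)).
apply: near_eq_cvg; near=> t.
have t0 : t != 0 by near: t; exact: nbhs_dnbhs_neq.
rewrite /= addr0 normr0 powR0 ?gt_eqF// subr0 /GRing.scale/= mulr1.
rewrite normrM normfV.
rewrite [X in _ * X]ger0_norm ?powR_ge0// -(mulr_powRB1 (normr_ge0 t) a0).
by rewrite mulKf// normr_eq0.
Unshelve. all: by end_near. Qed.

Lemma is_derive1_compose (R : realType) (f g : R -> R) (x df dg : R) :
  is_derive x 1 g dg -> is_derive (g x) 1 f df ->
  is_derive x 1 (f \o g) (df * dg).
Proof.
move=> [gx gE] [fx fE].
have /derivable1_diffP dg' := gx; have /derivable1_diffP df' := fx.
apply: DeriveDef; first exact/derivable1_diffP/(differentiable_comp dg' df').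
by rewrite -derive1E (derive1_comp gx fx) !derive1E gE fE.
Qed.

Lemma is_derive_norm_powR (R : realType) (p c : R) : 1 < p -> 0 <= c ->
  is_derive (0 : R) (1 : R) (fun t : R => `|c + t| `^ p) (p * c `^ (p - 1)).
Proof.
move=> p1; rewrite le_eqVlt => /orP[/eqP <-|c0].
  rewrite powR0 ?mulr0 ?gt_eqF ?subr_gt0//.
  under eq_fun do rewrite add0r; exact: is_derive_norm_powR0.
apply: (@near_eq_is_derive _ _ _ ((fun u => u `^ p) \o (fun t : R => c + t))).
  near=> t; rewrite /= ger0_norm//.
  have : `|t| < c by near: t; exact: (@nbhs0_lt _ R _ c0).
  by rewrite ltr_norml => /andP[h _]; lra.
have ds : is_derive (0 : R) (1 : R) (fun t : R => c + t) 1.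
  have dc := is_deriveD (is_derive_cst c (0 : R) (1 : R))
    (is_derive_id (0 : R) (1 : R)).
  by apply: (is_derive_eq dc); rewrite add0r.
have cp : 0 < c + 0 by rewrite addr0.
have := is_derive1_compose ds (is_derive1_powR p cp).
by rewrite mulr1 addr0.
Unshelve. all: by end_near. Qed.

(** * Gradients and derivatives along lines *)

Lemma inner_is_scalar (R : realType) (d : nat) (g : 'rV[R]_d) :
  scalar (inner g).
Proof.
move=> k x y; rewrite /inner mulr_sumr -big_split/=; apply: eq_bigr => i _.
by rewrite !mxE mulrDr mulrCA.
Qed.

Lemma innerB (R : realType) (d : nat) (g x y : 'rV[R]_d) :
  inner g (x - y) = inner g x - inner g y.
Proof.
rewrite /inner -sumrB; apply: eq_bigr => i _.
by rewrite !mxE mulrBr.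
Qed.

Lemma scalar_coord (R : realType) (d : nat) (L : 'rV[R]_d -> R) : scalar L ->
  forall x, L x = inner (\row_i L (delta_mx 0 i)) x.
Proof.
move=> linL x.
pose Ll : {scalar 'rV[R]_d} :=
  HB.pack L (GRing.isLinear.Build _ _ _ _ L linL).
rewrite -[L]/(Ll : _ -> _) {1}(row_sum_delta x) linear_sum.
by apply: eq_bigr => i _; rewrite linearZ_LR mxE mulrC.
Qed.

(** Every derivative below is computed along a line, which reduces it to the
    calculus of functions of one real variable. *)
Lemma derive_line (R : realType) (d : nat) (h : 'rV[R]_d -> R) x v :
  'D_v h x = 'D_1 (fun t : R => h (x + t *: v)) 0.
Proof.
rewrite /derive.
suff -> : (fun t : R => t^-1 *: ((h \o shift x) (t *: v) - h x)) =
  (fun t : R => t^-1 *: (((fun t : R => h (x + t *: v)) \o shift 0) (t *: 1)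
                        - h (x + 0 *: v))) by [].
apply/funext => t /=.
by rewrite addr0 scale0r addr0 [t *: 1]mulr1 (addrC x).
Qed.

(** [grad] only records the partial derivatives.  It represents the directional
    derivatives as soon as these depend linearly on the direction. *)
Lemma inner_grad (R : realType) (d : nat) (h L : 'rV[R]_d -> R) x :
  scalar L ->
  (forall v, is_derive (0 : R) (1 : R) (fun t : R => h (x + t *: v)) (L v)) ->
  forall v, inner (grad h x) v = L v.
Proof.
move=> linL dh v; rewrite (scalar_coord linL); congr inner.
by apply/rowP => i; rewrite !mxE derive_line derive_val.
Qed.

Lemma is_derive_scalar (R : realType) (d : nat) (L : 'rV[R]_d -> R) x v :
  scalar L -> is_derive (0 : R) (1 : R) (fun t : R => L (x + t *: v)) (L v).
Proof.
move=> linL.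
rewrite (_ : (fun t => _) = cst (L x) + L v \*: id); last first.
  by apply/funext => t; rewrite (addrC x) linL !fctE/= [_ *: t]mulrC addrC.
have dl := is_deriveD (is_derive_cst (L x) (0 : R) (1 : R))
  (is_deriveZ (L v) (is_derive_id (0 : R) (1 : R))).
by apply: (is_derive_eq dl); rewrite add0r [_ *: _]mulr1.
Qed.

Lemma is_derive_bigsum (R : realType) (I : finType) (P : pred I)
    (F : I -> R -> R) (dF : I -> R) (x : R) :
  (forall i, P i -> is_derive x 1 (F i) (dF i)) ->
  is_derive x 1 (fun t => \sum_(i | P i) F i t) (\sum_(i | P i) dF i).
Proof.
move=> dFi; rewrite (_ : (fun t => _) = \sum_(i | P i) F i).
  elim/big_ind2 : _ => [|f df g dg|//]; first exact: is_derive_cst.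
  exact: is_deriveD.
by apply/funext => t; rewrite fct_sumE.
Qed.

Lemma inner_grad_scalar (R : realType) (d : nat) (L : 'rV[R]_d -> R) x :
  scalar L -> forall v, inner (grad L x) v = L v.
Proof.
by move=> linL; apply: inner_grad => // v; exact: is_derive_scalar.
Qed.

(** First-order optimality, one-sided because the minimiser may lie on the
    boundary of the feasible set. *)
Lemma derive_ge0_at_min (R : realType) (phi : R -> R) (l : R) :
  is_derive (0 : R) (1 : R) phi l ->
  (forall t, 0 < t <= 1 -> phi 0 <= phi t) -> 0 <= l.
Proof.
move=> [dphi <-] min0.
have c : t^-1 *: (phi t - phi 0) @[t --> 0^'+] --> 'D_1 phi 0.
  have : t^-1 *: ((phi \o shift 0) (t *: 1) - phi 0) @[t --> 0^']
      --> 'D_1 phi 0.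
    exact: dphi.
  move=> /cvg_dnbhs_at_right.
  by under eq_fun do rewrite /= addr0 [_ *: 1]mulr1.
apply: (cvgr_to_ge c); near=> t.
have t0 : 0 < t by [].
have t1 : t <= 1 by near: t; exact: nbhs_right_le.
by apply: mulr_ge0; rewrite ?invr_ge0 ?(ltW t0)// subr_ge0 min0// t0.
Unshelve. all: by end_near. Qed.

(** * Mirror descent with a constant linear loss *)

Lemma bregman_three_point (R : realType) (d : nat) (h : 'rV[R]_d -> R) x y z :
  bregman h z y - bregman h x y - bregman h z x
    = inner (grad h x) (z - x) - inner (grad h y) (z - x).
Proof. by rewrite /bregman !innerB; ring. Qed.

(** For a linear loss the mirror descent step minimises the loss itself plus a
    Bregman term, so it is a proximal step: the optimality condition in the
    direction [z - x] and the three-point identity control the loss at the new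
    point [x].  The term [bregman h x y] is discarded, by convexity. *)
Lemma proximal_step (R : realType) (d : nat) (K : set 'rV[R]_d)
    (h f : 'rV[R]_d -> R) (eta : R) x y z :
  scalar f ->
  (forall x v, is_derive (0 : R) (1 : R) (fun t : R => h (x + t *: v))
                 (inner (grad h x) v)) ->
  (forall x z, 0 <= bregman h z x) ->
  (forall x z, K x -> K z -> forall t, 0 <= t <= 1 -> K (x + t *: (z - x))) ->
  0 < eta -> K z ->
  is_argmin K (fun w => f w + eta^-1 * bregman h w y) x ->
  f x - f z <= eta^-1 * (bregman h z y - bregman h z x).
Proof.
move=> linf dh brg_ge0 cvxK eta0 Kz [Kx minx].
have eta1 : 0 <= eta^-1 by rewrite invr_ge0 ltW.
pose l := f (z - x)
  + eta^-1 * (inner (grad h x) (z - x) - inner (grad h y) (z - x)).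
have l0 : 0 <= l.
  pose phi (t : R) := f (x + t *: (z - x)) + eta^-1 *
    (h (x + t *: (z - x)) - inner (grad h y) (x + t *: (z - x))).
  have dphi : is_derive (0 : R) (1 : R) phi l.
    have d1 := is_derive_scalar x (z - x) linf.
    have d2 := dh x (z - x).
    have d3 := is_derive_scalar x (z - x) (inner_is_scalar (grad h y)).
    exact: (is_deriveD d1 (is_deriveZ eta^-1 (is_deriveB d2 d3))).
  apply: (derive_ge0_at_min dphi) => t /andP[t0 t1].
  have := minx _ (cvxK x z Kx Kz t _); rewrite (ltW t0) t1 => /(_ isT).
  rewrite /phi scale0r addr0 /bregman !innerB.
  by move=> H; lra.
have fB : f (z - x) = f z - f x.
  by rewrite -[z - x]addrC -scaleN1r linf mulN1r addrC.
have etaB0 := mulr_ge0 eta1 (brg_ge0 y x).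
by move: l0; rewrite /l fB -(bregman_three_point h) => l0; lra.
Qed.

(** Summing [proximal_step] telescopes the Bregman terms.  The step bounds the
    loss at the iterate it produces, whence the extra term for the first
    iterate. *)
Lemma omd_linear_regret (R : realType) (d : nat) (K : set 'rV[R]_d)
    (h f : 'rV[R]_d -> R) (eta : R) x1 T (Y : nat -> 'rV[R]_d) z :
  scalar f ->
  (forall x v, is_derive (0 : R) (1 : R) (fun t : R => h (x + t *: v))
                 (inner (grad h x) v)) ->
  (forall x z, 0 <= bregman h z x) ->
  (forall x z, K x -> K z -> forall t, 0 <= t <= 1 -> K (x + t *: (z - x))) ->
  0 < eta -> K z -> (0 < T)%N ->
  omd_run K h eta x1 (fun=> f) T Y ->
  \sum_(1 <= t < T.+1) (f (Y t) - f z)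
    <= f x1 - f z + eta^-1 * bregman h z x1.
Proof.
move=> linf dh brg_ge0 cvxK eta0 Kz T0 [Y1 step].
have eta1 : 0 <= eta^-1 by rewrite invr_ge0 ltW.
suff H n : (n < T)%N -> \sum_(1 <= t < n.+2) (f (Y t) - f z)
    <= f x1 - f z + eta^-1 * (bregman h z x1 - bregman h z (Y n.+1)).
  case: T T0 step H => // T _ _ /(_ T (ltnSn T)) /le_trans; apply.
  by rewrite lerD2l ler_wpM2l// gerBl.
elim: n => [_|n IH nT]; first by rewrite big_nat1 Y1 subrr mulr0 addr0.
rewrite big_nat_recr//=.
have step' := step n.+1 nT.
have arg : is_argmin K (fun w => f w + eta^-1 * bregman h w (Y n.+1)) (Y n.+2).
  case: step' => KY minY; split=> // w Kw; have := minY w Kw.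
  by rewrite !inner_grad_scalar.
have := proximal_step linf dh brg_ge0 cvxK eta0 Kz arg.
by have := IH (ltnW nT); nra.
Qed.

Lemma omd_run_in (R : realType) (d : nat) (K : set 'rV[R]_d)
    (h : 'rV[R]_d -> R) (eta : R) x1 f T (Y : nat -> 'rV[R]_d) t :
  K x1 -> omd_run K h eta x1 f T Y -> (1 <= t <= T)%N -> K (Y t).
Proof.
move=> Kx1 [Y1 step]; case: t => [//|[|t]]; first by rewrite Y1.
by move=> /andP[_ tT]; have [] := step t.+1 tT.
Qed.

Lemma omd_run_exists (R : realType) (d : nat) (K : set 'rV[R]_d)
    (h : 'rV[R]_d -> R) (eta : R) x1 f T :
  (forall g y : 'rV[R]_d, exists x,
     is_argmin K (fun z => inner g z + eta^-1 * bregman h z y) x) ->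
  exists Y, omd_run K h eta x1 f T Y.
Proof.
move=> ex_argmin.
have /choice[step stepP] : forall ty : nat * 'rV[R]_d, exists x,
    is_argmin K (fun z => inner (grad (f ty.1) ty.2) z
                          + eta^-1 * bregman h z ty.2) x.
  by move=> ty; exact: ex_argmin.
pose Y := fix Y n := if n is n'.+1 then
  if n' is 0%N then x1 else step (n', Y n') else x1.
exists Y; split=> [//|[//|t] _]; exact: (stepP (t.+1, Y t.+1)).
Qed.

Lemma sup_attained (R : realType) (A : set R) (m : R) :
  A m -> (forall y, A y -> y <= m) -> sup A = m.
Proof.
move=> Am ubm; apply/eqP; rewrite eq_le; apply/andP; split.
  by apply: ge_sup; [exists m|exact: ubm].
by apply: ub_le_sup => //; exists m; exact: ubm.
Qed.

Lemma inf_attained (R : realType) (A : set R) (m : R) :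
  A m -> (forall y, A y -> m <= y) -> inf A = m.
Proof.
move=> Am lbm; apply/eqP; rewrite eq_le; apply/andP; split.
  by apply: ge_inf => //; exists m; exact: lbm.
by apply: lb_le_inf; [exists m|exact: lbm].
Qed.

Lemma bigmax_nat_const (R : realType) (T : nat) (c : R) : (0 < T)%N -> 0 <= c ->
  \big[Num.max/0]_(1 <= t < T.+1) c = c.
Proof.
move=> T0 c0; rewrite big_const_nat subSS subn0 -(prednK T0).
by elim: T.-1 => [|n IH]; [exact: max_l|rewrite iterS IH maxxx].
Qed.

Lemma regretE (R : realType) (d : nat) (K : set 'rV[R]_d)
    (f : 'rV[R]_d -> R) T (X : nat -> 'rV[R]_d) u :
  K u -> (forall z, K z -> f u <= f z) ->
  regret K (fun=> f) T X = \sum_(1 <= t < T.+1) (f (X t) - f u).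
Proof.
move=> Ku umin; rewrite /regret (inf_attained (m := \sum_(1 <= t < T.+1) f u)).
- by rewrite sumrB.
- by exists u.
- by move=> _ [z Kz <-]; apply: ler_sum => t _; exact: umin.
Qed.

Lemma regret_ge0 (R : realType) (d : nat) (K : set 'rV[R]_d)
    (f : 'rV[R]_d -> R) T (X : nat -> 'rV[R]_d) u :
  K u -> (forall z, K z -> f u <= f z) ->
  (forall t, (1 <= t <= T)%N -> K (X t)) -> 0 <= regret K (fun=> f) T X.
Proof.
move=> Ku umin KX; rewrite (regretE _ _ Ku umin) big_nat sumr_ge0// => t tT.
by rewrite subr_ge0; apply/umin/KX.
Qed.

(** * Geometry of the p-balls *)

(** The power mean inequality with its equality case, obtained by adding
    Bernoulli's inequalities for the ratios [w i / a].  It serves twice: for the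
    coordinates of a vector, where it is Holder's inequality against an
    indicator, and for the Euclidean norms of its blocks. *)
Lemma sum_le_of_sum_powR (R : realType) (I : finType) (A : {set I})
    (w : I -> R) (p a : R) :
  1 < p -> 0 < a -> (forall i, i \in A -> 0 <= w i) ->
  \sum_(i in A) w i `^ p <= #|A|%:R * a `^ p ->
  \sum_(i in A) w i <= #|A|%:R * a ?= iff [forall i in A, w i == a].
Proof.
move=> p1 a0 w0 wp.
have p0 : 0 < p by rewrite (lt_trans _ p1).
have lf : \sum_(i in A) (1 + p * (w i / a - 1)) <= \sum_(i in A) (w i / a) `^ p
    ?= iff [forall i in A, w i / a == 1].
  apply: leif_sum => i iA; apply: powR_ge_tangent1 => //.
  by rewrite divr_ge0 ?w0 ?(ltW a0).
have up : \sum_(i in A) (w i / a) `^ p <= #|A|%:R.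
  under eq_bigr => i iA do rewrite powRM ?w0 ?invr_ge0 ?ltW//.
  have aV : a^-1 `^ p = (a `^ p)^-1.
    by rewrite -powR_inv1 ?ltW// -powRrM mulN1r powRN.
  by rewrite -mulr_suml aV ler_pdivrMr ?powR_gt0.
have lhs : \sum_(i in A) (1 + p * (w i / a - 1))
    = #|A|%:R + p * ((\sum_(i in A) w i) / a - #|A|%:R).
  rewrite big_split/= sumr_const -mulr_sumr; congr (_ + p * _).
  by rewrite sumrB sumr_const mulr_suml.
have E : [forall i in A, w i / a == 1] = [forall i in A, w i == a].
  apply: eq_forallb_in => i iA.
  apply/eqP/eqP => [h|->]; last by rewrite divff ?gt_eqF.
  by rewrite -[w i](divfK (lt0r_neq0 a0)) h mul1r.
have le : \sum_(i in A) w i <= #|A|%:R * a.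
  rewrite -ler_pdivrMr// -subr_le0 -(pmulr_rle0 _ p0).
  by have := le_trans (lf.1) up; rewrite lhs gerDl.
split=> //; apply/idP/idP => [/eqP eqw|/forall_inP eqw].
  rewrite -E -lf.2 eq_le lf.1/= lhs eqw mulfK ?gt_eqF// subrr mulr0 addr0.
  exact: up.
rewrite (eq_bigr (fun=> a)) => [|i iA]; last exact/eqP/eqw.
by rewrite sumr_const mulr_natl.
Qed.

Section LpGeometry.
Context {R : realType} {d : nat}.
Implicit Types (p : R) (x y : 'rV[R]_d).

Lemma lpnorm_ge0 p x : 0 <= lpnorm p x.
Proof. exact: powR_ge0. Qed.

Lemma sum_powR_ge0 p x : 0 <= \sum_i `|x 0 i| `^ p.
Proof. by apply: sumr_ge0 => i _; exact: powR_ge0. Qed.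

Lemma lpnorm_powR p x : 0 < p -> lpnorm p x `^ p = \sum_i `|x 0 i| `^ p.
Proof.
by move=> p0; rewrite -powRrM mulVf ?gt_eqF// powRr1// sum_powR_ge0.
Qed.

Lemma lpnormZ p (r : R) x : 0 < p -> 0 <= r ->
  lpnorm p (r *: x) = r * lpnorm p x.
Proof.
move=> p0 r0; rewrite /lpnorm.
under eq_bigr => i _ do rewrite mxE normrM (ger0_norm r0) powRM ?normr_ge0//.
rewrite -mulr_sumr powRM ?powR_ge0 ?sum_powR_ge0//.
by rewrite -powRrM mulfV ?gt_eqF// powRr1.
Qed.

Lemma lpball_sum p x : 0 < p -> lpball p x <-> \sum_i `|x 0 i| `^ p <= 1.
Proof.
move=> p0; rewrite /lpball/=; split => h.
  rewrite -lpnorm_powR//; have -> : 1 = 1 `^ p :> R by rewrite powR1.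
  by apply: ge0_ler_powR; rewrite ?nnegrE ?lpnorm_ge0 ?(ltW p0).
have -> : 1 = 1 `^ p^-1 :> R by rewrite powR1.
by apply: ge0_ler_powR; rewrite ?nnegrE ?sum_powR_ge0 ?invr_ge0 ?(ltW p0).
Qed.

Lemma lpball0 p : 0 < p -> lpball p (0 : 'rV[R]_d).
Proof.
move=> p0; apply/lpball_sum => //.
by rewrite big1// => i _; rewrite mxE normr0 powR0 ?gt_eqF.
Qed.

Lemma lpball_coord p x i : 0 < p -> lpball p x -> `|x 0 i| <= 1.
Proof.
move=> p0 /lpball_sum - /(_ p0) h.
rewrite leNgt; apply/negP => xi.
have : 1 < `|x 0 i| `^ p.
  have -> : 1 = 1 `^ p :> R by rewrite powR1.
  by apply: gt0_ltr_powR; rewrite ?nnegrE.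
apply/negP; rewrite -leNgt; apply: le_trans h.
by rewrite (bigD1 i)//= lerDl sumr_ge0// => j _; exact: powR_ge0.
Qed.

Lemma lpball_convex p x z t : 1 <= p -> lpball p x -> lpball p z ->
  0 <= t <= 1 -> lpball p (x + t *: (z - x)).
Proof.
move=> p1; have p0 : 0 < p by rewrite (lt_le_trans _ p1).
move=> /lpball_sum - /(_ p0) hx /lpball_sum - /(_ p0) hz t01.
have /andP[t0 t1] := t01.
apply/lpball_sum => //.
have : (1 - t) * (\sum_i `|x 0 i| `^ p) + t * (\sum_i `|z 0 i| `^ p) <= 1.
  have t1' : 0 <= 1 - t by rewrite subr_ge0.
  by have := ler_wpM2l t1' hx; have := ler_wpM2l t0 hz; lra.
apply: le_trans; rewrite !mulr_sumr -big_split/=; apply: ler_sum => i _.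
apply: le_trans (powR_convex p1 t01 (normr_ge0 _) (normr_ge0 _)).
apply: ge0_ler_powR; rewrite ?nnegrE// ?(ltW p0)//.
  by rewrite addr_ge0// mulr_ge0// subr_ge0.
rewrite !mxE -[X in X * `|x 0 i|]ger0_norm ?subr_ge0//.
rewrite -[X in X * `|z 0 i|]ger0_norm// -!normrM.
by rewrite (le_trans _ (ler_normD _ _))// le_eqVlt; apply/orP; left;
  apply/eqP; congr `|_|; ring.
Qed.

Lemma lpball_compact p : 0 < p -> compact (lpball p : set 'rV[R]_d).
Proof.
move=> p0; apply: bounded_closed_compact.
  exists 1; split=> // M M1 x xK; apply: le_trans (ltW M1).
  rewrite [leLHS]/Num.norm/= mx_normrE.
  apply/bigmax_leP; split=> // -[i j] _ /=.
  by rewrite (ord1 i); exact: lpball_coord xK.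
have -> : lpball p =
    (fun x : 'rV[R]_d => \sum_i `|x 0 i| `^ p) @^-1` [set t | t <= 1].
  by apply/seteqP; split=> x /lpball_sum; exact.
apply: closed_comp; last exact: closed_le.
move=> x _; move: x; apply: continuous_big => [|i _ x].
  exact: add_continuous.
apply: (@continuous_comp 'rV[R]_d R R (fun y => y 0 i) (fun u => `|u| `^ p)).
  exact: coord_continuous.
exact: continuous_norm_powR.
Qed.

Lemma restr_norm2_ge0 (A : {set 'I_d}) x : 0 <= restr_norm2 A x.
Proof. exact: sqrtr_ge0. Qed.

Lemma restr_norm2_sqr (A : {set 'I_d}) x :
  restr_norm2 A x ^+ 2 = \sum_(i in A) x 0 i ^+ 2.
Proof. by rewrite sqr_sqrtr// sumr_ge0// => i _; exact: sqr_ge0. Qed.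

(** On a block the Euclidean norm is at most the [p]-norm since [p <= 2]: each
    ratio [`|x 0 i| / m] is at most [1], so its square is at most its [p]-th
    power. *)
Lemma restr_norm2_powR_le p (A : {set 'I_d}) x : 0 < p -> p <= 2 ->
  restr_norm2 A x `^ p <= \sum_(i in A) `|x 0 i| `^ p.
Proof.
move=> p0 p2; have := restr_norm2_ge0 A x; set m := restr_norm2 A x.
rewrite le_eqVlt => /orP[/eqP <-|m0].
  by rewrite powR0 ?gt_eqF// sumr_ge0// => i _; exact: powR_ge0.
have -> : m `^ p = \sum_(i in A) (x 0 i / m) ^+ 2 * m `^ p.
  rewrite -mulr_suml; under eq_bigr do rewrite expr_div_n.
  by rewrite -mulr_suml -restr_norm2_sqr divff ?mul1r// expf_eq0 gt_eqF.
apply: ler_sum => i iA.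
have -> : `|x 0 i| = `|x 0 i| / m * m by rewrite divfK// gt_eqF.
have xm0 : 0 <= `|x 0 i| / m by rewrite divr_ge0// ltW.
rewrite powRM ?(ltW m0)// ler_pM2r ?powR_gt0//.
have -> : (x 0 i / m) ^+ 2 = (`|x 0 i| / m) `^ 2%:R.
  by rewrite powR_mulrn// !expr_div_n real_normK ?num_real.
have [->|xm] := eqVneq (`|x 0 i| / m) 0; first by rewrite !powR0// gt_eqF.
apply: ger_powR => //; rewrite lt_neqAle eq_sym xm xm0/= ler_pdivrMr// mul1r.
rewrite -[m]ger0_norm ?(ltW m0)// -ler_sqr ?nnegrE// !real_normK ?num_real//.
rewrite restr_norm2_sqr (bigD1 i)//= lerDl sumr_ge0// => j _; exact: sqr_ge0.
Qed.

End LpGeometry.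

(** * Powers of block norms *)

Section BlockNorm.
Context {R : realType} {d : nat}.
Implicit Types (x z v : 'rV[R]_d) (A : {set 'I_d}).

Lemma restr_norm2_eq0 A x : restr_norm2 A x = 0 ->
  forall i, i \in A -> x 0 i = 0.
Proof.
move=> x0 i iA; have := restr_norm2_sqr A x; rewrite x0 expr0n/= => /esym/eqP.
rewrite psumr_eq0 => [/allP/(_ i)|j _]; last exact: sqr_ge0.
by rewrite mem_index_enum iA/= sqrf_eq0 => /(_ isT)/eqP.
Qed.

Lemma restr_norm2Z A (r : R) x :
  restr_norm2 A (r *: x) = `|r| * restr_norm2 A x.
Proof.
rewrite /restr_norm2; under eq_bigr do rewrite mxE exprMn.
by rewrite -mulr_sumr sqrtrM ?sqr_ge0// sqrtr_sqr.
Qed.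

Lemma restr_norm2_cauchy_schwarz A x z :
  \sum_(i in A) x 0 i * z 0 i <= restr_norm2 A x * restr_norm2 A z.
Proof.
set m := restr_norm2 A x; set M := restr_norm2 A z.
have [m0|m0] := eqVneq m 0.
  by rewrite m0 mul0r big1// => i /(restr_norm2_eq0 m0) ->; rewrite mul0r.
have [M0|M0] := eqVneq M 0.
  by rewrite M0 mulr0 big1// => i /(restr_norm2_eq0 M0) ->; rewrite mulr0.
have mM0 : 0 < m * M.
  by rewrite mulr_gt0// lt0r ?m0 ?M0 restr_norm2_ge0.
have : 0 <= \sum_(i in A) (m * z 0 i - M * x 0 i) ^+ 2.
  by apply: sumr_ge0 => i _; exact: sqr_ge0.
have -> : \sum_(i in A) (m * z 0 i - M * x 0 i) ^+ 2 =
    m ^+ 2 * (\sum_(i in A) z 0 i ^+ 2) + M ^+ 2 * (\sum_(i in A) x 0 i ^+ 2)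
    - 2 * (m * M) * \sum_(i in A) x 0 i * z 0 i.
  rewrite !mulr_sumr -big_split/= -sumrB; apply: eq_bigr => i _; ring.
rewrite -!restr_norm2_sqr -/m -/M => h.
rewrite -(ler_pM2l mM0); lra.
Qed.

(** Where the block of [x] vanishes the function is [`|t| `^ a] up to a constant
    factor and has derivative [0]; elsewhere it is a power of a positive
    quadratic polynomial in [t].  At a vanishing block the stated derivative is
    [0] because every term of the sum has a factor [x 0 i]. *)
Lemma is_derive_restr_norm2_powR (a : R) A x v : 1 < a ->
  is_derive (0 : R) (1 : R) (fun t : R => restr_norm2 A (x + t *: v) `^ a)
    (a * restr_norm2 A x `^ (a - 2) * \sum_(i in A) x 0 i * v 0 i).
Proof.
move=> a1; have a0 : 0 < a by rewrite (lt_trans _ a1).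
set B := \sum_(i in A) _.
have [m0|m0] := eqVneq (restr_norm2 A x) 0.
  have xA := restr_norm2_eq0 m0.
  rewrite /B big1 ?mulr0 => [|i /xA ->]; last by rewrite mul0r.
  have -> : (fun t : R => restr_norm2 A (x + t *: v) `^ a) =
      restr_norm2 A v `^ a \*: (fun t : R => `|t| `^ a).
    apply/funext => t /=.
    have -> : restr_norm2 A (x + t *: v) = `|t| * restr_norm2 A v.
      rewrite -restr_norm2Z /restr_norm2; congr Num.sqrt.
      by apply: eq_bigr => i /xA xi; rewrite !mxE xi add0r.
    by rewrite powRM ?restr_norm2_ge0// [RHS]mulrC.
  have dn := is_derive_norm_powR0 a1.
  by apply: (is_derive_eq (is_deriveZ _ dn)); rewrite scaler0.
have {}m0 : 0 < restr_norm2 A x by rewrite lt0r m0 restr_norm2_ge0.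
set m := restr_norm2 A x in m0 *.
pose C := \sum_(i in A) v 0 i ^+ 2.
pose Q (t : R) := m ^+ 2 + (2 * B * t + C * t ^+ 2).
have QE t : restr_norm2 A (x + t *: v) ^+ 2 = Q t.
  rewrite restr_norm2_sqr /Q /m restr_norm2_sqr /B /C !(mulr_sumr, mulr_suml).
  rewrite -!big_split/=; apply: eq_bigr => i _; rewrite !mxE; ring.
have dQ : is_derive (0 : R) (1 : R) Q (2 * B).
  rewrite (_ : Q = cst (m ^+ 2) + ((2 * B) \*: id + C \*: (id ^+ 2 : R -> R))).
    have di := is_derive_id (0 : R) (1 : R).
    have dq := is_deriveD (is_derive_cst (m ^+ 2) (0 : R) (1 : R))
      (is_deriveD (is_deriveZ (2 * B) di) (is_deriveZ C (is_deriveX 2 di))).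
    apply: (is_derive_eq dq).
    by rewrite add0r /= expr1 mulr0 scale0r scaler0 addr0 [_ *: _]mulr1.
  by apply/funext => t; rewrite !fctE.
have Q0 : Q 0 = m ^+ 2 by rewrite /Q mulr0 expr0n mulr0 !addr0.
have Q0gt : 0 < Q 0 by rewrite Q0 exprn_gt0.
have := is_derive1_compose dQ (is_derive1_powR (a / 2) Q0gt).
have -> : (fun u => u `^ (a / 2)) \o Q =
    (fun t : R => restr_norm2 A (x + t *: v) `^ a).
  apply/funext => t /=; rewrite -QE -powR_mulrn ?restr_norm2_ge0// -powRrM.
  by congr (_ `^ _); rewrite mulrC divfK.
suff -> : a / 2 * Q 0 `^ (a / 2 - 1) * (2 * B) = a * m `^ (a - 2) * B by [].
rewrite Q0 -powR_mulrn ?ltW// -powRrM.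
have -> : 2%:R * (a / 2 - 1) = a - 2 :> R by field.
by field.
Qed.

(** Convexity of the block terms: the tangent inequality for the norms, and the
    Cauchy-Schwarz inequality to replace the product of the norms by the inner
    product. *)
Lemma restr_norm2_powR_ge_tangent (a : R) A x z : 1 < a ->
  restr_norm2 A x `^ a
    + a * restr_norm2 A x `^ (a - 2) * \sum_(i in A) x 0 i * (z - x) 0 i
    <= restr_norm2 A z `^ a.
Proof.
move=> a1; have a0 : 0 < a by rewrite (lt_trans _ a1).
set m := restr_norm2 A x; set M := restr_norm2 A z.
have [m0|m0] := eqVneq m 0.
  rewrite big1 => [|i /(restr_norm2_eq0 m0) ->]; last by rewrite mul0r.
  by rewrite mulr0 addr0 m0 powR0 ?gt_eqF// powR_ge0.
have {}m0 : 0 < m by rewrite lt0r m0 restr_norm2_ge0.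
apply: le_trans (powR_ge_tangent a1 (ltW m0) (restr_norm2_ge0 A z)).
rewrite lerD2l -!mulrA ler_pM2l// -/M.
have -> : m `^ (a - 1) = m `^ (a - 2) * m.
  have -> : a - 2 = (a - 1) - 1 by lra.
  by rewrite mulrC mulr_powRB1 ?(ltW m0)// subr_gt0.
rewrite -mulrA ler_pM2l ?powR_gt0//.
have -> : \sum_(i in A) x 0 i * (z - x) 0 i =
    \sum_(i in A) x 0 i * z 0 i - m ^+ 2.
  rewrite restr_norm2_sqr -sumrB; apply: eq_bigr => i _; rewrite !mxE; ring.
by rewrite mulrBr lerB ?restr_norm2_cauchy_schwarz.
Qed.

Lemma continuous_restr_norm2_powR (a : R) A : 0 < a ->
  continuous (fun x : 'rV[R]_d => restr_norm2 A x `^ a).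
Proof.
move=> a0 x.
rewrite (_ : (fun x : 'rV[R]_d => restr_norm2 A x `^ a) =
  (fun u : R => `|u| `^ a) \o
    (Num.sqrt \o (fun y : 'rV[R]_d => \sum_(i in A) y 0 i ^+ 2))).
  apply: continuous_comp; last exact: continuous_norm_powR.
  apply: continuous_comp; last exact: sqrt_continuous.
  apply: continuous_big => [|i _ y]; first exact: add_continuous.
  apply: (@continuous_comp 'rV[R]_d R R (fun y => y 0 i) (fun u => u ^+ 2)).
    exact: coord_continuous.
  exact: exprn_continuous.
by apply/funext => y /=; rewrite ger0_norm// sqrtr_ge0.
Qed.

End BlockNorm.

(** * The block mirror map *)

Section BlockMirrorMap.
Context {R : realType} {d : nat}.
Implicit Types (x z v y : 'rV[R]_d) (P : {set {set 'I_d}}) (rho : R).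

Definition mirror_coef P rho : R := rho ^+ 2 * (gamma_ #|P| * p_ #|P|)^-1.

Lemma h_block_normE P rho x : h_block_norm P rho x =
  mirror_coef P rho * \sum_(A in P) restr_norm2 A (rho^-1 *: x) `^ p_ #|P|.
Proof. by rewrite /h_block_norm /h_block mulrA. Qed.

Definition dh_block_norm P rho x v : R := mirror_coef P rho *
  \sum_(A in P) (p_ #|P| * restr_norm2 A (rho^-1 *: x) `^ (p_ #|P| - 2) *
     \sum_(i in A) (rho^-1 *: x) 0 i * (rho^-1 *: v) 0 i).

Lemma dh_block_norm_scalar P rho x : scalar (dh_block_norm P rho x).
Proof.
move=> k u v; rewrite /dh_block_norm mulrCA -mulrDr; congr (_ * _).
rewrite mulr_sumr -big_split/=; apply: eq_bigr => A _.
rewrite mulrCA -mulrDr; congr (_ * _).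
rewrite mulr_sumr -big_split/=; apply: eq_bigr => i _; rewrite !mxE; ring.
Qed.

Lemma is_derive_h_block_norm P rho x v : 1 < p_ #|P| :> R ->
  is_derive (0 : R) (1 : R) (fun t : R => h_block_norm P rho (x + t *: v))
    (dh_block_norm P rho x v).
Proof.
move=> a1.
rewrite (_ : (fun t => _) = (fun t : R => mirror_coef P rho * \sum_(A in P)
    restr_norm2 A (rho^-1 *: x + t *: (rho^-1 *: v)) `^ p_ #|P|)).
  have ds := is_derive_bigsum (fun A (_ : A \in P) =>
    is_derive_restr_norm2_powR A (rho^-1 *: x) (rho^-1 *: v) a1).
  exact: (is_deriveZ (mirror_coef P rho) ds).
apply/funext => t; rewrite h_block_normE; apply: (congr1 ( *%R _)).
by apply: eq_bigr => A _; rewrite scalerDr !scalerA mulrC.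
Qed.

Lemma inner_grad_h_block_norm P rho x v : 1 < p_ #|P| :> R ->
  inner (grad (h_block_norm P rho) x) v = dh_block_norm P rho x v.
Proof.
move=> a1; apply: (inner_grad (dh_block_norm_scalar P rho x)) => w.
exact: is_derive_h_block_norm.
Qed.

Lemma bregman_h_block_norm_ge0 P rho x z : 1 < p_ #|P| :> R ->
  0 <= mirror_coef P rho -> 0 <= bregman (h_block_norm P rho) z x.
Proof.
move=> a1 k0; rewrite /bregman inner_grad_h_block_norm// !h_block_normE.
rewrite -mulrBr -mulrBr mulr_ge0// -!sumrB sumr_ge0// => A _.
have := restr_norm2_powR_ge_tangent A (rho^-1 *: x) (rho^-1 *: z) a1.
by rewrite -scalerBr subr_ge0 lerBrDl.
Qed.

Lemma h_block_norm0 P rho : 1 < p_ #|P| :> R -> h_block_norm P rho 0 = 0.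
Proof.
move=> a1; rewrite h_block_normE big1 ?mulr0// => A _.
rewrite scaler0 /restr_norm2 big1 ?sqrtr0 => [|i _]; last by rewrite mxE expr0n.
by rewrite powR0 // gt_eqF// (lt_trans _ a1).
Qed.

Lemma bregman_h_block_norm0 P rho z : 1 < p_ #|P| :> R ->
  bregman (h_block_norm P rho) z 0 = h_block_norm P rho z.
Proof.
move=> a1; rewrite /bregman inner_grad_h_block_norm// h_block_norm0//.
rewrite /dh_block_norm big1 ?mulr0 ?subr0// => A _.
by rewrite big1 ?mulr0// => i _; rewrite !mxE mulr0 mul0r.
Qed.

Lemma continuous_mull (T : topologicalType) (k : R) (f : T -> R) :
  continuous f -> continuous (fun t => k * f t).
Proof.
by move=> cf t; exact: (continuousM (@cst_continuous _ _ k t) (cf t)).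
Qed.

Lemma continuous_h_block_norm P rho : 1 < p_ #|P| :> R ->
  continuous (h_block_norm P rho : 'rV[R]_d -> R).
Proof.
move=> a1.
rewrite (_ : h_block_norm P rho = (fun x => mirror_coef P rho *
   \sum_(A in P) restr_norm2 A (rho^-1 *: x) `^ p_ #|P|)); last first.
  by apply/funext => y; rewrite h_block_normE.
apply: continuous_mull.
apply: continuous_big => [|A _ y]; first exact: add_continuous.
apply: (@continuous_comp 'rV[R]_d 'rV[R]_d R (fun y => rho^-1 *: y)
   (fun w => restr_norm2 A w `^ p_ #|P|)).
  exact: scaler_continuous.
by apply: continuous_restr_norm2_powR; rewrite (lt_trans _ a1).
Qed.

(** For a point of block norm at most [rho] the rescaled block norms are at
    most [1] and add up to at most [1], and an exponent above [1] only lowers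
    them. *)
Lemma h_block_norm_le P rho z : 1 < p_ #|P| :> R -> 0 < rho ->
  0 <= mirror_coef P rho ->
  block_norm P z <= rho -> h_block_norm P rho z <= mirror_coef P rho.
Proof.
move=> a1 rho0 k0 zrho; rewrite h_block_normE ler_piMr//.
apply: le_trans (_ : rho^-1 * block_norm P z <= 1); last first.
  by rewrite mulrC ler_pdivrMr// mul1r.
rewrite /block_norm mulr_sumr; apply: ler_sum => A AP.
rewrite restr_norm2Z ger0_norm ?invr_ge0 ?(ltW rho0)//.
set w := rho^-1 * _.
have w0 : 0 <= w by rewrite mulr_ge0 ?invr_ge0 ?(ltW rho0)// restr_norm2_ge0.
have w1 : w <= 1.
  rewrite /w mulrC ler_pdivrMr// mul1r; apply: le_trans zrho.
  rewrite /block_norm (bigD1 A)//= lerDl sumr_ge0// => B _.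
  exact: restr_norm2_ge0.
have [->|wn0] := eqVneq w 0; first by rewrite powR0 // gt_eqF// (lt_trans _ a1).
by apply: ge1r_powR; rewrite ?(ltW a1)// lt0r wn0 w0.
Qed.

Lemma h_block_norm_gt0 P rho z A i : 1 < p_ #|P| :> R -> 0 < rho ->
  0 < mirror_coef P rho -> A \in P -> i \in A -> z 0 i != 0 ->
  0 < h_block_norm P rho z.
Proof.
move=> a1 rho0 k0 AP iA zi; rewrite h_block_normE mulr_gt0//.
rewrite (bigD1 A)//= ltr_pwDl ?sumr_ge0// => [|B _]; last exact: powR_ge0.
rewrite powR_gt0// lt0r restr_norm2_ge0 andbT.
apply/negP => /eqP /restr_norm2_eq0 /(_ i iA); apply/eqP.
by rewrite mxE mulf_neq0// invr_eq0 gt_eqF.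
Qed.

(** The step minimises a continuous function on a compact set. *)
Lemma argmin_exists (K : set 'rV[R]_d) (h : 'rV[R]_d -> R) eta g y :
  compact K -> K !=set0 -> continuous h ->
  exists x, is_argmin K (fun z => inner g z + eta^-1 * bregman h z y) x.
Proof.
move=> cK K0 ch.
have ci (g' : 'rV[R]_d) : continuous (inner g').
  apply: continuous_big => [|i _]; first exact: add_continuous.
  exact/continuous_mull/coord_continuous.
have c : continuous (fun z => inner g z + eta^-1 * bregman h z y).
  rewrite (_ : (fun z => _) = inner g + (fun z => eta^-1 *
     (h - cst (h y) - (inner (grad h y) - cst (inner (grad h y) y))) z)).
    move=> x; apply: continuousD; first exact: ci.
    apply: continuous_mull => {}x.
    apply: continuousB; apply: continuousB;
      by [exact: ch|exact: ci|exact: cst_continuous].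
  by apply/funext => z; rewrite /bregman innerB.
have [x xK xmin] := compact_EVT_min K0 cK (continuous_subspaceT c).
exists x; split; first by rewrite inE in xK.
by move=> z Kz; apply: xmin; rewrite inE.
Qed.

End BlockMirrorMap.

(** * Random equal-size partitions *)

Lemma card_ord_lt (n m : nat) :
  (m <= n)%N -> #|[set i : 'I_n | (i < m)%N]%SET| = m.
Proof.
by move=> mn; rewrite -sum1dep_card (big_ord_narrow mn) sum1_card card_ord.
Qed.

Section RandomPartition.
Variables (d s : nat).
Implicit Types (A U V S : {set 'I_d}) (P : {set {set 'I_d}}).
Implicit Types (sigma : {perm 'I_d}).

(** For nonempty [U], proportional to the probability that one block of a uniform
    equal-size partition contains [U]. *)
Definition cover_count U : nat :=
  \sum_(P in eqparts d s) #|[set A in P | U \subset A]%SET|.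

Lemma eqparts_perm sigma P :
  ([set sigma @: A | A : {set 'I_d} in P]%SET \in eqparts d s)
    = (P \in eqparts d s).
Proof.
have inj_s := @perm_inj _ sigma.
rewrite !inE card_imset ?imset_partition; last exact: imset_inj.
have sigmaT : (sigma @: [set: 'I_d] = [set: 'I_d])%SET.
  by apply/eqP; rewrite eqEcard finset.subsetT card_imset//=.
rewrite -{1}sigmaT imset_partition//; congr [&& _, _ & _].
apply/forall_inP/forall_inP => sz A AP; apply/forall_inP => B BP.
  have /forall_inP := sz _ (imset_f _ AP) => /(_ _ (imset_f _ BP)).
  by rewrite !card_imset.
case/imsetP: AP BP => A' A'P -> /imsetP[B' B'P ->]; rewrite !card_imset//.
by have /forall_inP := sz _ A'P; exact.
Qed.

Lemma cover_count_perm sigma U : cover_count (sigma @: U) = cover_count U.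
Proof.
have inj_s := @perm_inj _ sigma; have inj_i := imset_inj inj_s.
rewrite /cover_count (reindex_inj (imset_inj inj_i)) /=.
apply: eq_big => [P|P _]; first exact: eqparts_perm.
rewrite -[RHS](card_imset _ inj_i); congr #|pred_of_set _|.
apply/setP => B; rewrite !inE; apply/andP/imsetP.
  move=> [/imsetP[A AP ->] sUA]; exists A => //; rewrite inE AP/=.
  apply/fintype.subsetP => i iU.
  have /fintype.subsetP := sUA => /(_ _ (imset_f _ iU)).
  by rewrite mem_imset.
move=> [A]; rewrite inE => /andP[AP UA] ->.
by rewrite imset_f// imsetS.
Qed.

(** The symmetric group acts on the equal-size partitions, so only the size of
    [U] matters.  Transpositions suffice: each brings [U] one element closer
    to [V]. *)
Lemma cover_count_card U V : #|U| = #|V| -> cover_count U = cover_count V.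
Proof.
have [n] := ubnP #|V :\: U|; elim: n U => // n IH U le_n UV.
have [VU|[y]] := set_0Vmem (V :\: U).
  move/eqP: VU; rewrite finset.setD_eq0 => VU.
  congr cover_count; apply/esym/eqP.
  by rewrite eqEcard VU UV leqnn.
rewrite inE => /andP[yU yV].
have [x xU xV] : exists2 x, x \in U & x \notin V.
  apply/subsetPn; apply: contra yU => sUV.
  by have /eqP -> : U == V by rewrite eqEcard sUV UV leqnn.
pose t := tperm x y.
have mem_t i : (i \in t @: U) = (t i \in U).
  by rewrite -{1}(tpermK x y i) mem_imset//; exact: perm_inj.
rewrite -(cover_count_perm t U); apply: IH; last first.
  by rewrite card_imset//; exact: perm_inj.
rewrite ltnS in le_n; apply: leq_trans le_n.
apply: proper_card; apply/properP; split.
  apply/fintype.subsetP => i; rewrite !finset.in_setD mem_t.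
  move=> /andP[tiU iV]; rewrite iV andbT.
  apply: contra tiU => iU; rewrite tpermD//.
    by apply: contraNneq xV => ->.
  by apply: contraNneq yU => ->.
exists y; first by rewrite finset.in_setD yU yV.
by rewrite finset.in_setD mem_t tpermR xU.
Qed.

(** [2 ^ #|A :&: S|] counts the subsets of [S] contained in [A]. *)
Lemma sum_pow2_blocks S :
  (\sum_(P in eqparts d s) \sum_(A in P) 2 ^ #|A :&: S|
    = \sum_(U in powerset S) cover_count U)%N.
Proof.
rewrite /cover_count exchange_big/=; apply: eq_bigr => P _.
under [RHS]eq_bigr do rewrite -sum1_card.
under [RHS]eq_bigr do under eq_bigl do rewrite inE.
under [RHS]eq_bigr do rewrite big_mkcondr/=.
rewrite exchange_big/=; apply: eq_bigr => A _.
rewrite -big_mkcondr/= sum1_card -card_powerset.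
by apply: eq_card => U; rewrite [RHS]unfold_in !inE finset.subsetI andbC.
Qed.

Variable R : realType.

Lemma sum_powerset_card A (f : nat -> R) n : (#|A| <= n)%N ->
  \sum_(U in powerset A) f #|U| = \sum_(k < n.+1) 'C(#|A|, k)%:R * f k.
Proof.
move=> An.
rewrite (partition_big (fun U : {set 'I_d} => inord #|U| : 'I_n.+1) xpredT)//=.
apply: eq_bigr => k _.
rewrite (eq_bigr (fun=> f k)) => [|U]; last first.
  rewrite powersetE => /andP[UA /eqP <-]; rewrite inordK// ltnS.
  exact: leq_trans (subset_leq_card UA) An.
rewrite sumr_const mulr_natl -cards_draws; congr (_ *+ _).
apply: eq_card => U; rewrite [LHS]unfold_in !inE.
apply: andb_id2l => UA; apply/eqP/eqP => [<-|->]; last exact: inord_val.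
by rewrite inordK// ltnS (leq_trans (subset_leq_card UA) An).
Qed.

Hypothesis s_gt0 : (0 < s)%N.
Hypothesis le_sd : (s <= d)%N.

Let theta : R := s%:R / d%:R.

Let d_gt0 : 0 < d%:R :> R.
Proof. by rewrite ltr0n (leq_trans s_gt0). Qed.

(** The probability that a given set of [k] coordinates lies in a random set of
    [s] of the [d] coordinates is at most [(s / d) ^ k]. *)
Lemma bin_ratio k : 'C(s, k)%:R <= 'C(d, k)%:R * theta ^+ k :> R.
Proof.
have h : (s ^_ k * d ^ k <= d ^_ k * s ^ k)%N.
  elim: k => [|k IH]; first by rewrite !ffactn0 !expn0.
  rewrite !ffactnSr !expnSr.
  rewrite mulnACA [leqRHS]mulnACA leq_mul//.
  by rewrite !mulnBl [X in (X - _ <= _)%N]mulnC leq_sub2l// leq_mul2l le_sd orbT.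
rewrite -(@ler_pM2r _ (k`!%:R)) ?ltr0n ?fact_gt0//.
rewrite mulrAC -!natrM !bin_ffact /theta expr_div_n mulrA ler_pdivlMr ?exprn_gt0//.
by rewrite -!natrX -!natrM ler_nat.
Qed.

(** [cover_count] depends on the size only, so the sum over the subsets of the
    fixed set [S] equals an average over all sets of size [s]; there the sets of
    size [k] have weight at most [theta ^ k], and the binomial theorem sums the
    weights over the subsets of each block. *)
Lemma sum_pow2_blocks_le S : #|S| = s ->
  \sum_(P in eqparts d s) \sum_(A in P) 2 ^+ #|A :&: S|
    <= \sum_(P in eqparts d s) \sum_(A in P) (1 + theta) ^+ #|A| :> R.
Proof.
move=> cS.
pose w k : R := (cover_count [set i : 'I_d | (i < k)%N]%SET)%:R.
have wE U : (cover_count U)%:R = w #|U|.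
  congr (_%:R); apply: cover_count_card; rewrite card_ord_lt//.
  by rewrite -[leqRHS]card_ord max_card.
have theta0 : 0 <= theta by rewrite divr_ge0// ler0n.
have w0 k : 0 <= w k by exact: ler0n.
have -> : \sum_(P in eqparts d s) \sum_(A in P) 2 ^+ #|A :&: S|
    = \sum_(U in powerset S) w #|U|.
  transitivity ((\sum_(U in powerset S) cover_count U)%N%:R : R).
    rewrite -sum_pow2_blocks natr_sum; apply: eq_bigr => P _.
    by rewrite natr_sum; apply: eq_bigr => A _; rewrite natrX.
  by rewrite natr_sum; apply: eq_bigr => U _; rewrite wE.
have -> : \sum_(P in eqparts d s) \sum_(A in P) (1 + theta) ^+ #|A|
    = \sum_(U in powerset [set: 'I_d]) w #|U| * theta ^+ #|U|.
  transitivity (\sum_(P in eqparts d s) \sum_(A in P)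
      \sum_(U in powerset A) theta ^+ #|U|).
    apply: eq_bigr => P _; apply: eq_bigr => A _.
    rewrite (sum_powerset_card (fun k => theta ^+ k) (leqnn #|A|)) exprDn.
    by apply: eq_bigr => k _; rewrite expr1n mul1r mulr_natl.
  under [RHS]eq_bigr do rewrite -wE /cover_count natr_sum mulr_suml.
  rewrite [RHS]exchange_big/=; apply: eq_bigr => P _.
  under [RHS]eq_bigr do rewrite -sum1_card natr_sum mulr_suml.
  under [RHS]eq_bigr do under eq_bigl do rewrite inE.
  under [RHS]eq_bigr do rewrite big_mkcondr/=.
  rewrite [RHS]exchange_big/=; apply: eq_bigr => A _.
  rewrite -big_mkcondr/=; apply: eq_big => [U|U _]; last by rewrite mul1r.
  by rewrite !powersetE finset.subsetT.
have lSd : (#|S| <= d)%N by rewrite cS.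
rewrite (sum_powerset_card _ lSd) cS.
rewrite (sum_powerset_card (fun k => w k * theta ^+ k) (max_card _)).
rewrite cardsT card_ord; apply: ler_sum => k _.
by rewrite [leRHS]mulrCA [leLHS]mulrC ler_wpM2l// bin_ratio.
Qed.

Lemma eqparts_block_card P A : P \in eqparts d s -> A \in P ->
  (s * #|A|.-1 <= d)%N.
Proof.
rewrite inE => /and3P[partP /eqP <- /forall_inP sz] AP.
have := card_partition partP; rewrite cardsT card_ord => dE.
apply: (@leq_trans (\sum_(B in P) #|B|)%N); last by rewrite -dE.
rewrite -sum_nat_const; apply: leq_sum => B BP.
by have /forall_inP/(_ B BP) := sz A AP; case: #|A|.
Qed.

(** An equal-size block has at most [d / s + 1] elements, so the power is at
    most [(1 + theta) * expR (theta * (d / s))]. *)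
Lemma pow_block_le P A : P \in eqparts d s -> A \in P ->
  (1 + theta) ^+ #|A| <= 2 * expR 1.
Proof.
move=> PE AP; have := eqparts_block_card PE AP.
have theta1 : theta <= 1 by rewrite ler_pdivrMr// mul1r ler_nat.
have theta0 : 0 <= theta by rewrite divr_ge0// ler0n.
have A0 : (0 < #|A|)%N.
  move: PE; rewrite inE => /and3P[partP _ _].
  by rewrite card_gt0; exact: partition_neq0 partP AP.
rewrite -[in (1 + theta) ^+ _](prednK A0) exprS => le.
apply: ler_pM; rewrite ?exprn_ge0 ?addr_ge0//; first lra.
apply: le_trans (_ : expR theta ^+ #|A|.-1 <= _).
  by rewrite lerXn2r ?nnegrE ?expR_ge0 ?addr_ge0// expR_ge1Dx.
rewrite -expRM_natl ler_expR /theta mulrA ler_pdivrMr// mul1r.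
by rewrite -natrM ler_nat mulnC.
Qed.

Lemma expect_pow2_blocks_le S : #|S| = s ->
  \sum_(P in eqparts d s) \sum_(A in P) 2 ^+ #|A :&: S|
    <= #|eqparts d s|%:R * (s%:R * (2 * expR 1)) :> R.
Proof.
move=> cS; apply: le_trans (sum_pow2_blocks_le cS) _.
rewrite mulr_natl -sumr_const; apply: ler_sum => P PE.
have cP : #|P| = s by move: PE; rewrite inE => /and3P[_ /eqP].
rewrite -[in leRHS]cP mulr_natl -sumr_const; apply: ler_sum => A AP.
exact: pow_block_le PE AP.
Qed.

End RandomPartition.

(** * Linear ramps *)

Definition ramp (R : realType) (a : R) (k : nat) : R := Num.min 1 (k%:R * a).

Lemma rampS (R : realType) (a : R) k : 0 <= a ->
  Num.min 1 (ramp a k + a) = ramp a k.+1.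
Proof.
move=> a0; rewrite /ramp -natr1 mulrDl mul1r.
have [ka|ka] := leP 1 (k%:R * a).
  by rewrite !min_l//; lra.
by [].
Qed.

Lemma ramp_ge0 (R : realType) (a : R) k : 0 <= a -> 0 <= ramp a k.
Proof. by move=> a0; rewrite le_min ler01 mulr_ge0// ler0n. Qed.

Section RampSum.
Context {R : realType}.
Variable a : R.
Hypothesis a0 : 0 < a.

Let ramp1 n : ramp a n <= 1.
Proof. by rewrite ge_min lexx. Qed.

Let rampS' k : ramp a k.+1 = Num.min 1 (ramp a k + a).
Proof. by rewrite rampS// ltW. Qed.

(** The ramp [1 - ramp a k] starts at [1], loses [a] at each step and stays at
    [0] once there; the square of a term drops by at most [2 * a] times the
    term, which telescopes. *)
Lemma ramp_sum_ge (T : nat) : 1 <= T%:R * a ->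
  (2 * a)^-1 <= \sum_(k < T) (1 - ramp a k).
Proof.
move=> Ta.
suff h n : 1 - (1 - ramp a n) ^+ 2 <= 2 * a * \sum_(k < n) (1 - ramp a k).
  have := h T; rewrite {1}/ramp min_l// subrr expr0n/= subr0 => {}h.
  by rewrite -div1r ler_pdivrMr ?mulr_gt0// mulrC.
elim: n => [|n IH].
  by rewrite /ramp mul0r min_r ?ler01// big_ord0; lra.
rewrite big_ord_recr/= rampS' mulrDr; have := ramp1 n.
by case: (leP 1 (ramp a n + a)) => h r1; nra.
Qed.

(** The square of a term drops by at least [2 * a] times the next term. *)
Lemma ramp_sum_le (T : nat) :
  \sum_(k < T) (1 - ramp a k) <= 1 + (2 * a)^-1.
Proof.
suff h n : 2 * a * \sum_(k < n.+1) (1 - ramp a k)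
    <= 2 * a + (1 - (1 - ramp a n) ^+ 2).
  case: T => [|n]; first by rewrite big_ord0 addr_ge0// invr_ge0 mulr_ge0// ltW.
  rewrite -(@ler_pM2l _ (2 * a)) ?mulr_gt0//; apply: le_trans (h n) _.
  rewrite mulrDr mulr1 mulfV ?gt_eqF ?mulr_gt0// lerD2l gerBl; exact: sqr_ge0.
elim: n => [|n IH].
  by rewrite big_ord_recl big_ord0 /ramp mul0r min_r ?ler01//; lra.
rewrite big_ord_recr/= mulrDr.
have := ramp1 n; move: IH; rewrite [ramp a n.+1]rampS'.
by case: (leP 1 (ramp a n + a)) => h IH r1; nra.
Qed.

End RampSum.

(** * The p-norm mirror map on a ray *)

Section LpMirrorMap.
Context {R : realType} {d : nat}.
Implicit Types (x z v y : 'rV[R]_d).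

Definition ind_loss (S : {set 'I_d}) x : R := - \sum_(i in S) x 0 i.

(** The point of the [p]-unit sphere with equal coordinates on [S]; it is the
    minimiser of [ind_loss S] on the ball. *)
Definition flat (p : R) (S : {set 'I_d}) : 'rV[R]_d :=
  \row_i (if i \in S then #|S|%:R `^ (- p^-1) else 0).

Lemma ind_loss_scalar (S : {set 'I_d}) : scalar (ind_loss S).
Proof.
move=> k x y; rewrite /ind_loss mulrN -opprD mulr_sumr -big_split/=.
by congr (- _); apply: eq_bigr => i _; rewrite !mxE.
Qed.

Lemma ind_lossZ (S : {set 'I_d}) (r : R) x :
  ind_loss S (r *: x) = r * ind_loss S x.
Proof.
rewrite /ind_loss mulrN mulr_sumr; congr (- _).
by apply: eq_bigr => i _; rewrite mxE.
Qed.

Lemma ind_loss0 (S : {set 'I_d}) : ind_loss S (0 : 'rV[R]_d) = 0.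
Proof. by rewrite -(scale0r (0 : 'rV[R]_d)) ind_lossZ mul0r. Qed.

Lemma grad_ind_loss (S : {set 'I_d}) x : grad (ind_loss S) x =
  \row_i (if i \in S then -1 else 0).
Proof.
apply/rowP => i; rewrite !mxE derive_line.
have ds := is_derive_scalar x (delta_mx 0 i) (ind_loss_scalar S).
rewrite derive_val /ind_loss; have [iS|iS] := ifPn.
  rewrite (bigD1 i)//= big1 => [|j /andP[_ ji]].
    by rewrite mxE !eqxx addr0.
  by rewrite mxE eqxx (negbTE ji).
rewrite big1 ?oppr0// => j jS; rewrite mxE eqxx/=.
by case: eqVneq => // ji; rewrite -ji jS in iS.
Qed.

Variables (p : R) (S : {set 'I_d}).
Hypotheses (p1 : 1 < p) (S0 : (0 < #|S|)%N).

Let p0 : 0 < p. Proof. exact: lt_trans p1. Qed.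
Let s0 : 0 < #|S|%:R :> R. Proof. by rewrite ltr0n. Qed.
Let N : R := #|S|%:R `^ (1 - p^-1).
Let u := flat p S.

Lemma card_powR_gt0 : 0 < N.
Proof. exact: powR_gt0. Qed.

Lemma card_mul_flat : #|S|%:R * #|S|%:R `^ (- p^-1) = N.
Proof.
rewrite -[X in X * _](@powRr1 R) ?ler0n// -powRD//.
by rewrite (gt_eqF s0) implybT.
Qed.

Lemma flat_powR : (#|S|%:R `^ (- p^-1)) `^ p = #|S|%:R^-1.
Proof. by rewrite -powRrM mulNr mulVf ?gt_eqF// powR_inv1// ltW. Qed.

Lemma lpnorm_flat : lpnorm p u = 1.
Proof.
rewrite /lpnorm (bigID (mem S))/= [X in _ + X]big1 => [|i iS]; last first.
  by rewrite mxE (negbTE iS) normr0 powR0// gt_eqF.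
rewrite (eq_bigr (fun=> #|S|%:R^-1)) => [|i iS]; last first.
  by rewrite mxE iS ger0_norm ?powR_ge0// flat_powR.
by rewrite sumr_const addr0 -[_ *+ _]mulr_natl divff ?powR1// gt_eqF.
Qed.

Lemma ind_loss_flat : ind_loss S u = - N.
Proof.
rewrite /ind_loss (eq_bigr (fun=> #|S|%:R `^ (- p^-1))) => [|i iS].
  by rewrite sumr_const -[_ *+ _]mulr_natl card_mul_flat.
by rewrite mxE iS.
Qed.

(** Holder's inequality against the indicator of [S].  Equality forces the
    coordinates on [S] to be equal and leaves no mass outside [S]. *)
Lemma ind_loss_ge x :
  - (N * lpnorm p x) <= ind_loss S x ?= iff (x == lpnorm p x *: u).
Proof.
have := lpnorm_ge0 p x; set rho := lpnorm p x.
rewrite le_eqVlt => /orP[/eqP r0|rho0].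
  have x0 : x = 0.
    have : lpnorm p x `^ p = 0 by rewrite -/rho -r0 powR0// gt_eqF.
    rewrite lpnorm_powR// => /eqP; rewrite psumr_eq0 => [/allP h|i _]; last first.
      exact: powR_ge0.
    apply/rowP => i; rewrite mxE.
    have := h i (mem_index_enum i); rewrite powR_eq0 normr_eq0 => /andP[/eqP]//.
  rewrite -r0 mulr0 oppr0 x0 /ind_loss big1 ?oppr0 ?scale0r ?eqxx => [|i _].
    exact/leif_refl.
  by rewrite mxE.
pose a := rho * #|S|%:R `^ (- p^-1).
have a0 : 0 < a by rewrite mulr_gt0// powR_gt0.
have sap : #|S|%:R * a `^ p = \sum_i `|x 0 i| `^ p.
  rewrite /a powRM ?powR_ge0 ?(ltW rho0)// flat_powR mulrCA divff ?gt_eqF//.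
  by rewrite mulr1 lpnorm_powR.
have sa : #|S|%:R * a = N * rho by rewrite /a mulrCA card_mul_flat mulrC.
have wp : \sum_(i in S) `|x 0 i| `^ p <= #|S|%:R * a `^ p.
  rewrite sap [leRHS](bigID (mem S))/= lerDl sumr_ge0// => i _; exact: powR_ge0.
have lf := sum_le_of_sum_powR p1 a0 (fun i _ => normr_ge0 (x 0 i)) wp.
have le1 : \sum_(i in S) x 0 i <= \sum_(i in S) `|x 0 i|.
  by apply: ler_sum => i _; exact: ler_norm.
have le2 := lf.1; rewrite sa in le2.
split; first by rewrite /ind_loss lerN2 (le_trans le1).
rewrite /ind_loss eqr_opp; apply/eqP/eqP => [E|->]; last first.
  rewrite (eq_bigr (fun=> a)) => [|i iS]; last by rewrite !mxE iS.
  by rewrite sumr_const -[_ *+ _]mulr_natl sa.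
have absE : \sum_(i in S) `|x 0 i| = #|S|%:R * a.
  by apply/eqP; rewrite eq_le sa le2 E le1.
have /forall_inP absa : [forall i in S, `|x 0 i| == a] by rewrite -lf.2 absE.
have offS : \sum_(i | i \notin S) `|x 0 i| `^ p = 0.
  have := sap; rewrite (bigID (mem S))/= (eq_bigr (fun=> a `^ p)) => [|i iS].
    by rewrite sumr_const -[_ *+ _]mulr_natl => h; lra.
  by rewrite (eqP (absa i iS)).
have pos : \sum_(i in S) (`|x 0 i| - x 0 i) = 0.
  by rewrite sumrB absE sa E subrr.
apply/rowP => i; rewrite !mxE; case: ifPn => iS.
  move/eqP: pos; rewrite psumr_eq0 => [/allP/(_ i (mem_index_enum i))|j _]; last first.
    by rewrite subr_ge0 ler_norm.
  by rewrite iS/= subr_eq0 (eqP (absa i iS)) => /eqP <-.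
move/eqP: offS; rewrite psumr_eq0 => [/allP/(_ i (mem_index_enum i))|j _].
  by rewrite iS/= powR_eq0 normr_eq0 mulr0 => /andP[/eqP].
exact: powR_ge0.
Qed.

(** On the ray through [flat p S] the mirror map has a gradient proportional to
    that of [ind_loss S], which is why the iterates stay on the ray. *)
Lemma grad_h_lp_flat (r : R) : 0 <= r ->
  grad (h_lp p) (r *: u) = \row_i (if i \in S then r / ((p - 1) * N) else 0).
Proof.
move=> r0; apply/rowP => i; rewrite !mxE derive_line.
have p10 : p - 1 != 0 by rewrite gt_eqF// subr_gt0.
move: r0; rewrite le_eqVlt => /orP[/eqP <-|r0].
  rewrite (_ : (fun t => _) = (2 * (p - 1))^-1 \*: (id ^+ 2 : R -> R)).
    by rewrite derive_val /= expr1 mulr0 scale0r scaler0 mul0r if_same.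
  apply/funext => t; rewrite /h_lp scale0r add0r [LHS]mulrC; congr (_ * _).
  rewrite /lpnorm (bigD1 i)//= big1 ?addr0 => [|j ji]; last first.
    by rewrite !mxE eqxx (negbTE ji) mulr0 normr0 powR0// gt_eqF.
  rewrite !mxE !eqxx mulr1 -powRrM mulfV ?gt_eqF// powRr1//.
  by rewrite real_normK ?num_real.
pose c := r * u 0 i.
have u0 : 0 <= u 0 i by rewrite mxE; case: ifP => // _; exact: powR_ge0.
have c0 : 0 <= c by rewrite mulr_ge0// ltW.
pose B := \sum_(j | j != i) `|r * u 0 j| `^ p.
pose psi (t : R) := B + `|c + t| `^ p.
have dpsi : is_derive (0 : R) (1 : R) psi (p * c `^ (p - 1)).
  have dc := is_derive_norm_powR p1 c0.
  have dB := is_deriveD (is_derive_cst B (0 : R) (1 : R)) dc.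
  by apply: (is_derive_eq dB); rewrite add0r.
have psiE t : \sum_j `|(r *: u + t *: delta_mx 0 i) 0 j| `^ p = psi t.
  rewrite (bigD1 i)//= addrC /psi; congr (_ + _); last first.
    by rewrite !mxE !eqxx mulr1 /c !mxE.
  by apply: eq_bigr => j ji; rewrite !mxE eqxx (negbTE ji) mulr0 addr0.
have psi0 : psi 0 = r `^ p.
  rewrite -psiE scale0r addr0 -lpnorm_powR// lpnormZ ?lpnorm_flat ?mulr1//.
  exact: ltW.
have psi0gt : 0 < psi 0 by rewrite psi0 powR_gt0.
have := is_derive1_compose dpsi (is_derive1_powR p^-1 psi0gt).
set comp := _ \o psi => dcomp.
rewrite (_ : (fun t => _) = (2 * (p - 1))^-1 \*: (comp ^+ 2)); last first.
  by apply/funext => t; rewrite /h_lp /lpnorm psiE [LHS]mulrC.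
rewrite derive_val expr1 /comp /= psi0 -!powRrM mulfV ?gt_eqF// powRr1 ?(ltW r0)//.
have -> : p * (p^-1 - 1) = 1 - p by rewrite mulrBr mulfV ?gt_eqF// mulr1.
rewrite /c powRM ?(ltW r0)//.
have -> : r `^ (1 - p) = (r `^ (p - 1))^-1 by rewrite -powRN opprB.
have rp0 : r `^ (p - 1) != 0 by rewrite gt_eqF// powR_gt0.
rewrite [u 0 i]mxE; case: ifPn => iS; last first.
  by rewrite powR0// !(mulr0, scaler0).
have -> : (#|S|%:R `^ (- p^-1)) `^ (p - 1) = N^-1.
  rewrite -powRrM /N -powRN; congr (_ `^ _).
  by rewrite mulrBr mulr1 mulNr mulVf ?gt_eqF//; lra.
have NN := gt_eqF card_powR_gt0; have pp := gt_eqF p0.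
rewrite /GRing.scale/=; field.
by rewrite NN pp rp0 p10.
Qed.

Lemma inner_grad_h_lp_flat (r : R) v : 0 <= r ->
  inner (grad (h_lp p) (r *: u)) v = - (r / ((p - 1) * N)) * ind_loss S v.
Proof.
move=> r0; rewrite grad_h_lp_flat// /ind_loss mulrNN mulr_sumr [LHS]/inner.
rewrite [RHS]big_mkcond/=; apply: eq_bigr => i _; rewrite mxE.
by case: ifP; rewrite ?mul0r.
Qed.

Lemma bregman_h_lp0 z : bregman (h_lp p) z 0 = h_lp p z.
Proof.
rewrite /bregman -[X in grad _ X](scale0r u) inner_grad_h_lp_flat//.
rewrite mul0r oppr0 mul0r subr0.
suff -> : h_lp p (0 : 'rV[R]_d) = 0 by rewrite subr0.
by rewrite /h_lp -(scale0r (0 : 'rV[R]_d)) lpnormZ// mul0r expr0n mul0r.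
Qed.

Lemma lpball_flat (r : R) : 0 <= r <= 1 -> lpball p (r *: u).
Proof.
by move=> /andP[r0 r1]; rewrite /lpball/= lpnormZ// lpnorm_flat mulr1.
Qed.

Lemma ind_loss_flat_min z : lpball p z -> ind_loss S u <= ind_loss S z.
Proof.
rewrite /lpball/= => z1; rewrite ind_loss_flat.
apply: le_trans (ind_loss_ge z).1.
by rewrite lerN2 ler_piMr// ltW// card_powR_gt0.
Qed.

(** On the ray the step is the projected gradient step of a function of the
    radius alone.  With [delta] the increment and [r'] the new radius, the
    objective exceeds its value at [r' *: u] by a nonnegative multiple of the gap in
    [ind_loss_ge] plus a positive multiple of [(lpnorm p z - r') ^+ 2], and both
    vanish only at [r' *: u]. *)
Lemma argmin_h_lp (eta r : R) x : 0 < eta -> 0 <= r ->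
  is_argmin (lpball p)
    (fun z => ind_loss S z + eta^-1 * bregman (h_lp p) z (r *: u)) x <->
  x = Num.min 1 (r + eta * (p - 1) * N) *: u.
Proof.
move=> eta0 r0; pose delta := eta * (p - 1) * N.
set Phi := (fun z => _); set r' := Num.min _ _.
have p10 : 0 < p - 1 by rewrite subr_gt0.
have N0 := card_powR_gt0.
have delta0 : 0 < delta by rewrite !mulr_gt0.
pose kappa := (eta * (p - 1))^-1.
have kappa0 : 0 < kappa by rewrite invr_gt0 mulr_gt0.
have r'01 : 0 <= r' <= 1.
  by rewrite /r' le_min ler01 addr_ge0 ?(ltW delta0)//= ge_min lexx.
pose C := - eta^-1 * (h_lp p (r *: u) + r / ((p - 1) * N) * ind_loss S (r *: u)).
have PhiE z : Phi z = (1 + r / delta) * ind_loss S z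
                      + kappa * (lpnorm p z ^+ 2 / 2) + C.
  rewrite /Phi /bregman innerB !inner_grad_h_lp_flat// /C /kappa /delta.
  rewrite {1}/h_lp; field.
  by rewrite !gt_eqF.
have gap z : lpball p z -> (1 + r / delta) * (ind_loss S z + N * lpnorm p z)
    + kappa * ((lpnorm p z - r') ^+ 2 / 2) <= Phi z - Phi (r' *: u).
  rewrite /lpball/= => z1; have /andP[r'0 r'1] := r'01.
  rewrite !PhiE lpnormZ// lpnorm_flat mulr1.
  have -> : ind_loss S (r' *: u) = - (N * r').
    by rewrite ind_lossZ ind_loss_flat mulrN mulrC.
  set rho := lpnorm p z in z1 *.
  have KN : (1 + r / delta) * N = kappa * (r + delta).
    by rewrite /kappa /delta; field; rewrite !gt_eqF.
  (* [r'] is the projection of [r + delta] onto [rho <= 1]. *)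
  suff : 0 <= kappa * ((rho - r') * (r' - (r + delta))) by nra.
  rewrite mulr_ge0 ?(ltW kappa0)// /r' -/delta.
  by rewrite /Num.min; case: ltP => [h|h]; [nra|rewrite subrr mulr0].
have one_pos : 0 < 1 + r / delta by rewrite ltr_pwDl// divr_ge0// ltW.
have ge0 z : 0 <= ind_loss S z + N * lpnorm p z.
  by rewrite -lerBlDr sub0r (ind_loss_ge z).1.
split=> [[Kx minx]|->]; last first.
  split; first exact: lpball_flat.
  move=> z Kz; rewrite -subr_ge0; apply: le_trans (gap z Kz).
  rewrite addr_ge0// mulr_ge0 ?ge0 ?divr_ge0 ?sqr_ge0//;
    by rewrite ltW.
have := gap x Kx; have := minx _ (lpball_flat r'01); rewrite -subr_le0.
set G := Phi x - _ => G0 gapx.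
have t1 : 0 <= (1 + r / delta) * (ind_loss S x + N * lpnorm p x).
  by rewrite mulr_ge0// ltW.
have t2 : 0 <= kappa * ((lpnorm p x - r') ^+ 2 / 2).
  by rewrite mulr_ge0 ?divr_ge0 ?sqr_ge0// ltW.
have : (1 + r / delta) * (ind_loss S x + N * lpnorm p x) = 0 by lra.
move/eqP; rewrite mulf_eq0 (gt_eqF one_pos)/= => e1.
have : kappa * ((lpnorm p x - r') ^+ 2 / 2) = 0 by lra.
move/eqP; rewrite mulf_eq0 (gt_eqF kappa0)/= mulf_eq0 invr_eq0 pnatr_eq0 orbF.
rewrite sqrf_eq0 subr_eq0 => /eqP rhoE.
rewrite -rhoE; apply/eqP; rewrite -(ind_loss_ge x).2 eq_sym.
by rewrite -subr_eq0 opprK.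
Qed.

End LpMirrorMap.

(** * Regret of the p-norm mirror map *)

Section LpRun.
Context {R : realType} {d : nat}.
Variables (p : R) (S : {set 'I_d}).
Hypotheses (p1 : 1 < p) (S0 : (0 < #|S|)%N).
Let N : R := #|S|%:R `^ (1 - p^-1).
Let u : 'rV[R]_d := flat p S.
Variable eta : R.
Hypothesis eta0 : 0 < eta.
Let delta := eta * (p - 1) * N.

Let delta_gt0 : 0 < delta.
Proof. by rewrite !mulr_gt0 ?subr_gt0// card_powR_gt0. Qed.

Lemma argmin_ramp k x :
  is_argmin (lpball p) (fun z => inner (grad (ind_loss S) (ramp delta k *: u)) z
       + eta^-1 * bregman (h_lp p) z (ramp delta k *: u)) x
  <-> x = ramp delta k.+1 *: u.
Proof.
rewrite (_ : (fun z => _) = (fun z => ind_loss S z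
    + eta^-1 * bregman (h_lp p) z (ramp delta k *: u))).
  rewrite -rampS ?(ltW delta_gt0)//.
  by apply: argmin_h_lp => //; exact/ramp_ge0/ltW.
apply/funext => z; congr (_ + _).
exact: (inner_grad_scalar _ (ind_loss_scalar S)).
Qed.

Lemma lp_run_exists T :
  exists X, omd_run (lpball p) (h_lp p) eta 0 (fun=> ind_loss S) T X.
Proof.
exists (fun t => ramp delta t.-1 *: u); split.
  by rewrite /ramp mul0r min_r ?ler01// scale0r.
by case=> // t _; apply/argmin_ramp.
Qed.

(** The run is unique: its radius grows by [delta] per round until it reaches
    the boundary of the ball. *)
Lemma lp_run_eq T X :
  omd_run (lpball p) (h_lp p) eta 0 (fun=> ind_loss S) T X ->
  forall k, (k < T)%N -> X k.+1 = ramp delta k *: u.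
Proof.
move=> [X1 step]; elim=> [|k IH] kT.
  by rewrite X1 /ramp mul0r min_r ?ler01// scale0r.
have := step k.+1 kT; rewrite IH ?(ltnW kT)// => h.
exact/argmin_ramp.
Qed.

Lemma lp_regretE T X :
  omd_run (lpball p) (h_lp p) eta 0 (fun=> ind_loss S) T X ->
  regret (lpball p) (fun=> ind_loss S) T X
    = N * \sum_(k < T) (1 - ramp delta k).
Proof.
move=> run; rewrite (@regretE _ _ _ _ _ _ u); first last.
- by move=> z; exact: ind_loss_flat_min.
- by rewrite -[u]scale1r; apply: lpball_flat; rewrite // ler01 lexx.
rewrite big_add1/= big_mkord mulr_sumr; apply: eq_bigr => k _.
rewrite (lp_run_eq run)// ind_lossZ ind_loss_flat//.
rewrite /N; ring.
Qed.

End LpRun.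

Section LpStep.
Context {R : realType} {d : nat}.
Variables (p q : R) (S : {set 'I_d}) (T : nat).
Hypotheses (p1 : 1 < p) (p2 : p <= 2) (pq : p^-1 + q^-1 = 1).
Hypotheses (S0 : (0 < #|S|)%N) (T8 : 8 / (p - 1) <= T%:R).
Let N : R := #|S|%:R `^ (1 - p^-1).

Let p10 : 0 < p - 1. Proof. by rewrite subr_gt0. Qed.

Let N0 : 0 < N. Proof. exact: card_powR_gt0. Qed.

Let T8' : 8 <= (p - 1) * T%:R.
Proof. by rewrite -ler_pdivrMl// mulrC. Qed.

Let T_gt0 : 0 < T%:R :> R.
Proof. by apply: lt_le_trans T8; rewrite divr_gt0. Qed.

Let T_ge8 : 8 <= T%:R :> R.
Proof. by apply: le_trans T8' _; rewrite ler_piMl ?(ltW T_gt0)// lerBlDr. Qed.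

Lemma D_lpE : D_lp p (0 : 'rV[R]_d) = Num.sqrt (2 * (p - 1))^-1.
Proof.
congr Num.sqrt; apply: sup_attained.
  exists (flat p S).
    rewrite -[flat p S]scale1r.
    by apply: lpball_flat; rewrite // ler01 lexx.
  by rewrite (bregman_h_lp0 p1 S0) /h_lp lpnorm_flat// expr1n mul1r.
move=> _ [z z1 <-]; rewrite (bregman_h_lp0 p1 S0) /h_lp.
by rewrite ler_piMl ?invr_ge0 ?mulr_ge0 ?(ltW p10)// exprn_ile1 ?lpnorm_ge0.
Qed.

(** The losses have constant gradient, minus the indicator of [S]. *)
Lemma G_lpE : G_lp p q (fun=> ind_loss S) T = N.
Proof.
have T0 : (0 < T)%N by rewrite -(@ltr0n R).
have q0 : q != 0.
  apply/eqP => q0; move: pq; rewrite q0 invr0 addr0 => /eqP.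
  by rewrite invr_eq1 gt_eqF.
have gE : lpnorm q (\row_i (if i \in S then -1 else 0) : 'rV[R]_d) = N.
  have -> : N = #|S|%:R `^ q^-1.
    by rewrite /N; congr (_ `^ _); rewrite -pq; ring.
  rewrite /lpnorm; congr (_ `^ _); rewrite -sumr_const [RHS]big_mkcond/=.
  apply: eq_bigr => i _; rewrite mxE; case: ifP => _.
    by rewrite normrN1 powR1.
  by rewrite normr0 powR0.
rewrite /G_lp -[RHS](@bigmax_nat_const R T)// ?ltW//.
apply: eq_bigr => t _; apply: sup_attained.
  by exists 0; [exact/lpball0/(lt_trans ltr01)|rewrite grad_ind_loss].
by move=> _ [z _ <-]; rewrite grad_ind_loss gE.
Qed.

Let eta := eta_lp p q (0 : 'rV[R]_d) (fun=> ind_loss S) T.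

Lemma eta_lp_gt0 : 0 < eta.
Proof.
rewrite /eta /eta_lp /step_size D_lpE G_lpE.
by apply: divr_gt0; [|apply: mulr_gt0]; rewrite // sqrtr_gt0// invr_gt0 mulr_gt0.
Qed.

Let delta := eta * (p - 1) * N.

Let tau := Num.sqrt (T%:R / (p - 1)).

(** The standard step size makes the radius grow by [delta], with
    [delta ^-1 = sqrt 2 * tau]: this is the number of rounds up to the boundary. *)
Let delta_tau : 2 * (delta * tau) ^+ 2 = 1.
Proof.
have -> : delta = Num.sqrt (2 * (p - 1))^-1 * (p - 1) / Num.sqrt T%:R.
  rewrite /delta /eta /eta_lp /step_size D_lpE G_lpE; field.
  by rewrite !gt_eqF// sqrtr_gt0.
rewrite !exprMn exprVn !sqr_sqrtr ?divr_ge0 ?invr_ge0 ?mulr_ge0 ?ltW//.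
by field; rewrite !gt_eqF.
Qed.

Let delta_gt0 : 0 < delta.
Proof. by do 2!apply: mulr_gt0 => //; exact: eta_lp_gt0. Qed.

Let tau_ge1 : 2 <= tau.
Proof.
rewrite -(@ler_pXn2r _ 2) ?nnegrE ?sqrtr_ge0//.
rewrite sqr_sqrtr ?divr_ge0 ?(ltW T_gt0) ?(ltW p10)// ler_pdivlMr//.
by have h8 := T_ge8; have h2 := p2; lra.
Qed.

Lemma lp_regret_bounds X :
  omd_run (lpball p) (h_lp p) eta 0 (fun=> ind_loss S) T X ->
  2^-1 * (N * tau) <= regret (lpball p) (fun=> ind_loss S) T X <= 2 * (N * tau).
Proof.
move=> run; rewrite (lp_regretE p1 S0 eta_lp_gt0 run) -/delta -/N.
have t2 := tau_ge1; have tau0 : 0 < tau by lra.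
have dt := delta_tau; set w := delta * tau in dt.
have w0 : 0 < w by rewrite mulr_gt0.
have w1 : w <= 1 by nra.
have w2 : 2^-1 <= w by nra.
have w20 : 0 < 2 * w by lra.
have dE : (2 * delta)^-1 = tau / (2 * w).
  by rewrite /w; field; rewrite !gt_eqF.
(* The horizon exceeds the length of the ramp; this is where [T] has to be large
   compared with [(p - 1)^-1]. *)
have Tdelta : 1 <= T%:R * delta.
  have tauT : tau ^+ 2 * 8 <= T%:R ^+ 2.
    rewrite sqr_sqrtr ?divr_ge0 ?(ltW T_gt0) ?(ltW p10)// mulrAC ler_pdivrMr//.
    by have h8 := T8'; have hT := T_gt0; nra.
  have : (2 * tau) ^+ 2 <= T%:R ^+ 2 by have := sqr_ge0 tau; nra.
  rewrite ler_pXn2r ?nnegrE ?ler0n ?mulr_ge0 ?(ltW tau0)// => h.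
  apply: le_trans (_ : 2 * tau * delta <= _).
    by rewrite -mulrA [tau * _]mulrC -/w; lra.
  by rewrite ler_wpM2r// ltW.
have := ramp_sum_ge delta_gt0 Tdelta; have := ramp_sum_le delta_gt0 T.
set Sg := \sum_(k < T) _; rewrite dE => up low.
have l1 : tau / 2 <= tau / (2 * w).
  by rewrite ler_pM2l// lef_pV2 ?posrE//; lra.
have l2 : tau / (2 * w) <= tau.
  by rewrite ler_pdivrMr// ler_peMr ?(ltW tau0)//; lra.
apply/andP; split.
  by rewrite mulrCA ler_pM2l//; lra.
by rewrite mulrCA ler_pM2l//; lra.
Qed.

End LpStep.

(** * Regret of the block mirror map *)

Section ExpectPart.
Context {R : realType} {d : nat}.
Implicit Types (n : nat) (F G : {set {set 'I_d}} -> R).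

Lemma expect_part_empty n F : #|eqparts d n| = 0%N -> expect_part n F = 0.
Proof. by move=> e0; rewrite /expect_part e0 invr0 mulr0. Qed.

Lemma le_expect_part n F G :
  (forall P, P \in eqparts d n -> F P <= G P) ->
  expect_part n F <= expect_part n G.
Proof.
by move=> FG; rewrite ler_wpM2r ?invr_ge0 ?ler0n//; exact: ler_sum.
Qed.

Lemma expect_part_affine n (a b : R) F : (0 < #|eqparts d n|)%N ->
  expect_part n (fun P => a + b * F P) = a + b * expect_part n F.
Proof.
move=> n0; rewrite /expect_part big_split/= sumr_const -mulr_sumr mulrDl mulrA.
by rewrite -[X in X / _]mulr_natr mulfK// pnatr_eq0 -lt0n.
Qed.

Lemma expect_part_cst n (a : R) : (0 < #|eqparts d n|)%N ->
  expect_part n (fun _ : {set {set 'I_d}} => a) = a.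
Proof.
move=> n0; rewrite /expect_part sumr_const -[X in X / _]mulr_natr mulfK//.
by rewrite pnatr_eq0 -lt0n.
Qed.

Lemma expect_part_gt0 n F : (0 < #|eqparts d n|)%N ->
  (forall P, P \in eqparts d n -> 0 < F P) -> 0 < expect_part n F.
Proof.
move=> n0 F0; rewrite divr_gt0 ?ltr0n//.
have /card_gt0P[P PE] := n0.
rewrite (bigD1 P)//= ltr_pwDl ?F0// sumr_ge0// => Q /andP[QE _].
exact/ltW/F0.
Qed.

End ExpectPart.

Section BlockRun.
Context {R : realType} {d : nat}.
Variables (p : R) (S : {set 'I_d}) (T : nat).
Hypotheses (p1 : 1 < p) (p2 : p <= 2) (s3 : (2 < #|S|)%N) (T0 : (0 < T)%N).
Let s := #|S|.
Let N : R := s%:R `^ (1 - p^-1).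
Let K : set 'rV[R]_d := lpball p.
Let u : 'rV[R]_d := flat p S.
Let f := @ind_loss R d S.
Let rho : R := rho_ s K.

Let S0 : (0 < #|S|)%N. Proof. exact: leq_trans s3. Qed.
Let N0 : 0 < N. Proof. exact: card_powR_gt0. Qed.
Let p0 : 0 < p. Proof. exact: lt_trans p1. Qed.
Let K0 : K 0. Proof. exact: lpball0. Qed.
Let Ku : K u.
Proof. by rewrite -[u]scale1r; apply: lpball_flat; rewrite // ler01 lexx. Qed.

Lemma ln_card_gt0 : 0 < ln s%:R :> R.
Proof. by rewrite ln_gt0// ltr1n (leq_trans _ s3). Qed.

Lemma block_exponent_gt1 : 1 < p_ s :> R.
Proof. by rewrite /p_ ltrDl invr_gt0 ln_card_gt0. Qed.

Lemma eqparts_card P : P \in eqparts d s -> #|P| = s.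
Proof. by rewrite inE => /and3P[_ /eqP]. Qed.

Lemma block_norm_le P z : P \in eqparts d s -> K z -> block_norm P z <= N.
Proof.
move=> PE Kz; have cP := eqparts_card PE.
have s0 : 0 < s%:R :> R by rewrite ltr0n.
have a0 : 0 < s%:R `^ (- p^-1) :> R by rewrite powR_gt0.
have wp : \sum_(A in P) restr_norm2 A z `^ p
    <= #|P|%:R * (s%:R `^ (- p^-1)) `^ p.
  rewrite cP flat_powR// divff ?gt_eqF//.
  move: PE; rewrite inE => /and3P[partP _ _].
  apply: le_trans (iffLR (lpball_sum z p0) Kz).
  have -> : \sum_i `|z 0 i| `^ p = \sum_(i in [set: 'I_d]%SET) `|z 0 i| `^ p.
    by apply: eq_bigl => i; rewrite inE.
  rewrite (set_partition_big _ partP)/=; apply: ler_sum => A _.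
  exact: restr_norm2_powR_le.
have [+ _] := sum_le_of_sum_powR p1 a0 (fun A _ => restr_norm2_ge0 A z) wp.
by rewrite cP card_mul_flat.
Qed.

Lemma block_norm_rho P z : P \in eqparts d s -> K z -> block_norm P z <= rho.
Proof.
move=> PE Kz; rewrite /rho /rho_.
apply: le_trans (le_bigmax_cond _ _ PE).
apply: ub_le_sup; last by exists z.
by exists N => _ [w Kw <-]; exact: block_norm_le.
Qed.

Lemma rho_le : rho <= N.
Proof.
apply/bigmax_leP; split=> [|P PE]; first exact: ltW.
apply: ge_sup; first by exists (block_norm P 0), 0.
by move=> _ [w Kw <-]; exact: block_norm_le.
Qed.

Lemma block_meets P : P \in eqparts d s ->
  exists A i, [/\ A \in P, i \in A & i \in S].
Proof.
move=> PE; have /card_gt0P[i iS] := S0.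
move: PE; rewrite inE => /and3P[partP _ _].
have : i \in finset.cover P by rewrite (finset.cover_partition partP) inE.
by move=> /finset.bigcupP[A AP iA]; exists A, i.
Qed.

Let ui i : i \in S -> u 0 i != 0.
Proof. by move=> iS; rewrite mxE iS gt_eqF// powR_gt0// ltr0n. Qed.

Lemma rho_gt0 P : P \in eqparts d s -> 0 < rho.
Proof.
move=> PE; apply: lt_le_trans (block_norm_rho PE Ku).
have [A [i [AP iA iS]]] := block_meets PE.
rewrite /block_norm (bigD1 A)//= ltr_pwDl ?sumr_ge0// => [|B _]; last first.
  exact: restr_norm2_ge0.
rewrite lt0r restr_norm2_ge0 andbT; apply/eqP => /restr_norm2_eq0/(_ i iA)/eqP.
exact/negP/ui.
Qed.

Lemma mirror_coefE P : P \in eqparts d s ->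
  mirror_coef P rho = rho ^+ 2 * (expR 1 * ln s%:R / p_ s).
Proof.
move=> PE; rewrite /mirror_coef (eqparts_card PE) /gamma_ invfM invrK //.
Qed.

Lemma mirror_coef_gt0 P : P \in eqparts d s -> 0 < mirror_coef P rho.
Proof.
move=> PE; rewrite mirror_coefE// mulr_gt0 ?exprn_gt0 ?(rho_gt0 PE)//.
rewrite divr_gt0 ?(lt_trans _ block_exponent_gt1)//.
by rewrite mulr_gt0 ?expR_gt0 ?ln_card_gt0.
Qed.

Lemma mirror_coef_le P : P \in eqparts d s ->
  mirror_coef P rho <= N ^+ 2 * (expR 1 * ln s%:R).
Proof.
move=> PE; rewrite mirror_coefE//; apply: ler_pM.
- exact: sqr_ge0.
- rewrite divr_ge0 ?mulr_ge0 ?expR_ge0 ?(ltW ln_card_gt0)//.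
  by rewrite ltW// (lt_trans _ block_exponent_gt1).
- by rewrite lerXn2r ?nnegrE ?rho_le ?(ltW N0) ?(ltW (rho_gt0 PE)).
rewrite ler_pdivrMr ?(lt_trans _ block_exponent_gt1)// ler_peMr ?(ltW block_exponent_gt1)//.
by rewrite mulr_ge0 ?expR_ge0 ?(ltW ln_card_gt0).
Qed.

Let h P := h_block_norm P rho : 'rV[R]_d -> R.
Let V P := sup [set bregman (h P) z 0 | z in K].

Let a1 P : P \in eqparts d s -> 1 < p_ #|P| :> R.
Proof. by move=> /eqparts_card ->; exact: block_exponent_gt1. Qed.

Let h_le P z : P \in eqparts d s -> K z ->
  bregman (h P) z 0 <= mirror_coef P rho.
Proof.
move=> PE Kz; rewrite /h bregman_h_block_norm0 ?a1//.
apply: h_block_norm_le; rewrite ?a1 ?(rho_gt0 PE) ?(ltW (mirror_coef_gt0 PE))//.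
exact: block_norm_rho.
Qed.

(** [V P] is the squared Bregman diameter whose mean enters the step size. *)
Let V_le P : P \in eqparts d s -> V P <= N ^+ 2 * (expR 1 * ln s%:R).
Proof.
move=> PE; apply: le_trans (mirror_coef_le PE).
apply: ge_sup; first by exists (bregman (h P) 0 0), 0.
by move=> _ [z Kz <-]; exact: h_le.
Qed.

Let V_ge P z : P \in eqparts d s -> K z -> bregman (h P) z 0 <= V P.
Proof.
move=> PE Kz; apply: ub_le_sup; last by exists z.
by exists (mirror_coef P rho) => _ [w Kw <-]; exact: h_le.
Qed.

Let V_gt0 P : P \in eqparts d s -> 0 < V P.
Proof.
move=> PE; apply: lt_le_trans (V_ge PE Ku).
rewrite /h bregman_h_block_norm0 ?a1//.
have [A [i [AP iA iS]]] := block_meets PE.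
apply: (h_block_norm_gt0 (a1 PE) (rho_gt0 PE) (mirror_coef_gt0 PE) AP iA).
exact: ui.
Qed.

Let D : R := D_block s K 0.

Let D_sqr : (0 < #|eqparts d s|)%N -> D ^+ 2 = expect_part s V.
Proof.
by move=> n0; rewrite sqr_sqrtr// ltW//; apply: expect_part_gt0.
Qed.

Let D_gt0 : (0 < #|eqparts d s|)%N -> 0 < D.
Proof. by move=> n0; rewrite sqrtr_gt0; exact: expect_part_gt0. Qed.

Let D_sqr_le : (0 < #|eqparts d s|)%N -> D ^+ 2 <= N ^+ 2 * (expR 1 * ln s%:R).
Proof.
move=> n0; rewrite D_sqr// -[leRHS](expect_part_cst _ n0).
exact: le_expect_part.
Qed.

(** The gradient of the loss is minus the indicator of [S], so this is the
    largest number of elements of [S] in one block of [P]. *)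
Definition max_load P : R :=
  block_dual_norm P (\row_i (if i \in S then -1 else 0)) ^+ 2.

Lemma restr_norm2_ind A :
  restr_norm2 A (\row_i (if i \in S then -1 else 0) : 'rV[R]_d) ^+ 2
    = #|A :&: S|%:R.
Proof.
rewrite restr_norm2_sqr -sumr_const.
rewrite [LHS]big_mkcond [RHS]big_mkcond/=; apply: eq_bigr => i _.
rewrite inE mxE; case: (i \in A) => //=; case: (i \in S).
  by rewrite sqrrN expr1n.
by rewrite expr0n.
Qed.

Lemma max_load_gt0 P : P \in eqparts d s -> 0 < max_load P.
Proof.
move=> PE; have [A [i [AP iA iS]]] := block_meets PE.
rewrite exprn_gt0//; apply: lt_le_trans (le_bigmax_cond _ _ AP).
rewrite lt0r restr_norm2_ge0 andbT -sqrf_eq0 restr_norm2_ind pnatr_eq0 -lt0n.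
by apply/card_gt0P; exists i; rewrite inE iA.
Qed.

(** [m * ln 2 - ln s <= 2 ^ m / s] from [t <= expR t], and a maximum is at most
    the sum.  It turns exponential moments into a bound on the expectation. *)
Lemma max_load_le P :
  max_load P * ln 2 <= ln s%:R + (\sum_(A in P) 2 ^+ #|A :&: S|) / s%:R.
Proof.
have s0 : 0 < s%:R :> R by rewrite ltr0n.
have sum0 (Q : pred {set 'I_d}) :
    0 <= (\sum_(A in P | Q A) 2 ^+ #|A :&: S|) / s%:R :> R.
  by rewrite divr_ge0 ?ler0n// sumr_ge0// => A _; rewrite exprn_ge0.
rewrite /max_load /block_dual_norm; elim/big_ind : _ => [|x y hx hy|A AP].
- rewrite expr0n mul0r addr_ge0 ?(ltW ln_card_gt0)// divr_ge0 ?ler0n//.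
  by apply: sumr_ge0 => A _; rewrite exprn_ge0.
- by rewrite /Num.max; case: ifP.
rewrite restr_norm2_ind.
have l2 : 0 < ln 2 :> R by rewrite ln_gt0// ltr1n.
have := expR_ge1Dx (#|A :&: S|%:R * ln 2 - ln s%:R : R).
rewrite expRB expRM_natl !lnK ?posrE// => e1.
rewrite (bigD1 A)//= mulrDl.
have := sum0 (fun B => B != A); lra.
Qed.

Let cG : R := ((ln 2)^-1 * (2 * expR 1) + 1) / ln 2.

(** The expected maximal load is logarithmic, as for [s] balls thrown into [s]
    bins.  By [max_load_le] the mean of [max_load P * ln 2] is at most
    [ln s + 2 * expR 1], and [ln 2 <= ln s] absorbs the constant. *)
Let expect_max_load_le : (0 < #|eqparts d s|)%N -> (s <= d)%N ->
  expect_part s max_load <= cG * ln s%:R.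
Proof.
move=> n0 sd.
have s0 : 0 < s%:R :> R by rewrite ltr0n.
have l2 : 0 < ln 2 :> R by rewrite ln_gt0// ltr1n.
have e0 : 0 < #|eqparts d s|%:R :> R by rewrite ltr0n.
have ls : ln 2 <= ln s%:R :> R.
  by rewrite ler_ln ?posrE// ler_nat ltnW.
rewrite /cG mulrAC ler_pdivlMr//.
have : expect_part s (fun P => max_load P * ln 2) <= expect_part s
    (fun P => ln s%:R + s%:R^-1 * (\sum_(A in P) 2 ^+ #|A :&: S|)).
  by apply: le_expect_part => P _; rewrite [_^-1 * _]mulrC; exact: max_load_le.
rewrite expect_part_affine//.
rewrite [X in X <= _ -> _](_ : _ = expect_part s max_load * ln 2); last first.
  by rewrite /expect_part -mulr_suml mulrAC.
move=> /le_trans; apply.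
have : expect_part s (fun P => \sum_(A in P) 2 ^+ #|A :&: S|)
    <= s%:R * (2 * expR 1) :> R.
  rewrite ler_pdivrMr// mulrC.
  exact: expect_pow2_blocks_le.
rewrite -ler_pdivrMl// => le1.
have : (2 * expR 1) <= (ln 2)^-1 * (2 * expR 1) * ln s%:R :> R.
  rewrite mulrAC -[leLHS]mul1r ler_pM2r ?mulr_gt0 ?expR_gt0//.
  by rewrite mulrC ler_pdivlMr// mul1r.
lra.
Qed.

Let G : R := G_block s K (fun=> f) T.

Let GE : G = Num.sqrt (expect_part s max_load).
Proof.
rewrite /G /G_block -[RHS](@bigmax_nat_const R T)// ?sqrtr_ge0//.
apply: eq_bigr => t _; congr (Num.sqrt (expect_part s _)); apply/funext => P.
apply: sup_attained; first by exists 0; rewrite ?grad_ind_loss.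
by move=> _ [z _ <-]; rewrite grad_ind_loss.
Qed.

Let G_gt0 : (0 < #|eqparts d s|)%N -> 0 < G.
Proof.
move=> n0; rewrite GE sqrtr_gt0; apply: expect_part_gt0 => // P.
exact: max_load_gt0.
Qed.

Let eta : R := eta_block s K (0 : 'rV[R]_d) (fun=> f) T.

Let sqrtT : 0 < Num.sqrt T%:R :> R.
Proof. by rewrite sqrtr_gt0 ltr0n. Qed.

Lemma block_run_exists P : P \in eqparts d s ->
  exists Y, omd_run K (h_block_norm P rho) eta 0 (fun=> f) T Y.
Proof.
move=> PE; apply: omd_run_exists => g y; apply: argmin_exists.
- exact: lpball_compact.
- by exists 0.
- by apply: continuous_h_block_norm; exact: a1.
Qed.

(** All losses coincide, so no sequence of points of the ball beats the best
    fixed point. *)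
Lemma block_regret_ge0 P Y : P \in eqparts d s ->
  omd_run K (h_block_norm P rho) eta 0 (fun=> f) T Y ->
  0 <= regret K (fun=> f) T Y.
Proof.
move=> PE run; apply: (regret_ge0 Ku) => [z|t tT].
  exact: ind_loss_flat_min p1 S0 z.
exact: omd_run_in K0 run tT.
Qed.

Lemma block_regret_le P Y : P \in eqparts d s ->
  omd_run K (h_block_norm P rho) eta 0 (fun=> f) T Y ->
  regret K (fun=> f) T Y <= N + eta^-1 * V P.
Proof.
move=> PE run; have n0 : (0 < #|eqparts d s|)%N by apply/card_gt0P; exists P.
have eta0 : 0 < eta.
  apply: divr_gt0; first exact: D_gt0.
  by apply: mulr_gt0; [exact: G_gt0|].
rewrite (regretE _ _ Ku); last by move=> z; exact: ind_loss_flat_min.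
apply: le_trans (omd_linear_regret _ _ _ _ eta0 Ku T0 run) _.
- exact: ind_loss_scalar.
- move=> x v; rewrite (inner_grad_h_block_norm _ _ _ (a1 PE)).
  exact: is_derive_h_block_norm (a1 PE).
- move=> x z.
  exact: bregman_h_block_norm_ge0 (a1 PE) (ltW (mirror_coef_gt0 PE)).
- move=> x z Kx Kz t; exact: lpball_convex (ltW p1) Kx Kz.
apply: lerD; last by rewrite ler_wpM2l ?invr_ge0 ?(ltW eta0)// V_ge.
by rewrite /f /u ind_loss_flat// opprK ind_loss0 add0r.
Qed.

(** The mean of [V] is [D ^+ 2] and [eta] is [D / (G * sqrt T)], so the mean of
    the bounds in [block_regret_le] is [N + D * G * sqrt T], where [D ^+ 2] and
    [G ^+ 2] are at most [N ^+ 2 * (expR 1 * ln s)] and [cG * ln s]. *)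
Lemma expect_block_regret (Y : {set {set 'I_d}} -> nat -> 'rV[R]_d) :
  (s <= d)%N ->
  (forall P, P \in eqparts d s ->
    omd_run K (h_block_norm P rho) eta 0 (fun=> f) T (Y P)) ->
  0 <= expect_part s (fun P => regret K (fun=> f) T (Y P))
    <= (Num.sqrt (expR 1 * cG) + (ln 2)^-1) * (N * ln s%:R * Num.sqrt T%:R).
Proof.
move=> sd run.
have l2 : 0 < ln 2 :> R by rewrite ln_gt0// ltr1n.
have cG0 : 0 <= cG.
  by rewrite /cG divr_ge0 ?addr_ge0 ?mulr_ge0 ?invr_ge0 ?expR_ge0 ?(ltW l2).
have L0 := ln_card_gt0.
have bound0 : 0 <= (Num.sqrt (expR 1 * cG) + (ln 2)^-1)
    * (N * ln s%:R * Num.sqrt T%:R).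
  by rewrite !mulr_ge0 ?addr_ge0 ?invr_ge0 ?sqrtr_ge0 ?(ltW l2) ?(ltW N0) ?(ltW L0).
case: (posnP #|eqparts d s|) => [e0|n0].
  by rewrite expect_part_empty// lexx.
apply/andP; split.
  rewrite -[leLHS](expect_part_cst _ n0); apply: le_expect_part => P PE.
  exact: block_regret_ge0 (run P PE).
apply: le_trans (_ : expect_part s (fun P => N + eta^-1 * V P) <= _).
  by apply: le_expect_part => P PE; exact: block_regret_le (run P PE).
rewrite expect_part_affine// -D_sqr//.
have D0 := D_gt0 n0; have G0 := G_gt0 n0.
have -> : eta^-1 * D ^+ 2 = D * G * Num.sqrt T%:R.
  rewrite /eta /eta_block /step_size -/D -/G; field.
  by rewrite !gt_eqF.
have DG : D * G <= Num.sqrt (expR 1 * cG) * (N * ln s%:R).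
  have ecG : 0 <= expR 1 * cG by exact: mulr_ge0 (expR_ge0 _) cG0.
  have DG0 : 0 <= D * G by exact: mulr_ge0 (ltW D0) (ltW G0).
  have NL0 : 0 <= N * ln s%:R by exact: mulr_ge0 (ltW N0) (ltW L0).
  have rhs0 := mulr_ge0 (sqrtr_ge0 (expR 1 * cG)) NL0.
  rewrite -(@ler_pXn2r _ 2) ?nnegrE//.
  rewrite !exprMn [X in _ <= X * _](sqr_sqrtr ecG).
  have -> : expR 1 * cG * (N ^+ 2 * ln s%:R ^+ 2)
    = (N ^+ 2 * (expR 1 * ln s%:R)) * (cG * ln s%:R) by ring.
  apply: ler_pM; [exact: sqr_ge0|exact: sqr_ge0|exact: D_sqr_le|].
  rewrite GE sqr_sqrtr; first exact: expect_max_load_le.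
  by apply/ltW/expect_part_gt0 => // P; exact: max_load_gt0.
have T1 : 1 <= Num.sqrt T%:R :> R.
  by rewrite -[leLHS]sqrtr1; apply: ler_wsqrtr; rewrite ler1n.
have ls : 1 <= (ln 2)^-1 * ln s%:R :> R.
  by rewrite mulrC ler_pdivlMr// mul1r ler_ln ?posrE ?ltr0n// ?ler_nat// ltnW.
have : N <= (ln 2)^-1 * (N * ln s%:R * Num.sqrt T%:R).
  have -> : (ln 2)^-1 * (N * ln s%:R * Num.sqrt T%:R)
    = N * ((ln 2)^-1 * ln s%:R * Num.sqrt T%:R) by ring.
  by rewrite ler_peMr ?(ltW N0)// mulr_ege1.
have := ler_wpM2r (ltW sqrtT) DG.
lra.
Qed.

End BlockRun.

(** * Comparison of the two regrets *)

Theorem proposition2 (R : realType) :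
  exists c1 c2 C c : R,
    [/\ 0 < c1, 0 < c2, 0 < C & 0 < c] /\
    forall (p q : R) (s d T : nat),
      1 < p -> p <= 2 -> p^-1 + q^-1 = 1 ->
      (3 <= s)%N -> (s <= d)%N -> 8 / (p - 1) <= T%:R ->
      exists (f : nat -> 'rV[R]_d -> R) (S : {set 'I_d}),
        [/\ #|S| = s,
            forall t, scalar (f t),
            forall t x i, `|grad (f t) x 0 i| <= 1 &
            forall t x i, i \notin S -> grad (f t) x 0 i = 0] /\
        let K : set 'rV[R]_d := lpball p in
        let run_lp (X : nat -> 'rV[R]_d) :=
          omd_run K (h_lp p) (eta_lp p q 0 f T) 0 f T X in
        let run_block (P : {set {set 'I_d}}) (Y : nat -> 'rV[R]_d) :=
          omd_run K (h_block_norm P (rho_ s K)) (eta_block s K 0 f T) 0 f T Y in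
        (exists X, run_lp X) /\
        (forall P, P \in eqparts d s -> exists Y, run_block P Y) /\
        forall (X : nat -> 'rV[R]_d)
               (Y : {set {set 'I_d}} -> nat -> 'rV[R]_d),
          run_lp X -> (forall P, P \in eqparts d s -> run_block P (Y P)) ->
          let regret_lp := regret K f T X in
          let exp_regret_block := expect_part s (fun P => regret K f T (Y P)) in
          [/\ c1 * (s%:R `^ (1 - p^-1) * Num.sqrt (T%:R / (p - 1)))
                <= regret_lp,
              regret_lp
                <= c2 * (s%:R `^ (1 - p^-1) * Num.sqrt (T%:R / (p - 1))),
              `|exp_regret_block|
                <= C * (s%:R `^ (1 - p^-1) * ln s%:R * Num.sqrt T%:R) &
              c / (Num.sqrt (p - 1) * ln s%:R) * exp_regret_block
                <= regret_lp].
Proof.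
pose cG : R := ((ln 2)^-1 * (2 * expR 1) + 1) / ln 2.
pose C : R := Num.sqrt (expR 1 * cG) + (ln 2)^-1.
have ln2_gt0 : 0 < ln 2 :> R by rewrite ln_gt0// ltr1n.
have C0 : 0 < C by rewrite ltr_wpDl ?sqrtr_ge0// invr_gt0.
exists 2^-1, 2, C, (2^-1 / C); split; first by rewrite divr_gt0.
move=> p q s d T p1 p2 pq s3 sd T8.
pose S : {set 'I_d} := [set i : 'I_d | (i < s)%N]%SET.
have cS : #|S| = s by exact: card_ord_lt.
have p10 : 0 < p - 1 by rewrite subr_gt0.
have T0 : (0 < T)%N.
  by rewrite -(@ltr0n R); apply: lt_le_trans T8; rewrite divr_gt0.
have S3 : (2 < #|S|)%N by rewrite cS.
have S0 : (0 < #|S|)%N by rewrite (leq_trans _ S3).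
exists (fun=> ind_loss S), S; split.
  split=> //.
  - by move=> t; exact: ind_loss_scalar.
  - move=> t x i; rewrite grad_ind_loss mxE.
    by case: ifP; rewrite ?normrN1 ?normr0.
  - by move=> t x i iS; rewrite grad_ind_loss mxE (negbTE iS).
move=> K run_lp run_block; split.
  exact: (lp_run_exists p1 S0 (eta_lp_gt0 p1 pq S0 T8)).
have ex_block := block_run_exists T p1 S3.
have lp_bounds := lp_regret_bounds p1 p2 pq S0 T8.
have block_bounds := expect_block_regret p1 p2 S3 T0.
rewrite cS in ex_block lp_bounds block_bounds.
split; first exact: ex_block.
move=> X Y runX runY regret_lp exp_regret_block.
have /andP[low up] := lp_bounds X runX.
have /andP[ge0 le] := block_bounds Y sd runY.
set N := s%:R `^ (1 - p^-1) in low up le *.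
have lns : 0 < ln s%:R :> R by rewrite ln_gt0// ltr1n (leq_trans _ s3).
split=> //.
  rewrite ger0_norm//.
apply: le_trans low.
have sp0 : 0 < Num.sqrt (p - 1) by rewrite sqrtr_gt0.
rewrite sqrtrM ?ler0n// sqrtrV ?(ltW p10)//.
apply: le_trans (_ : 2^-1 / C / (Num.sqrt (p - 1) * ln s%:R)
    * (C * (N * ln s%:R * Num.sqrt T%:R)) <= _).
  by rewrite ler_wpM2l// ltW// !divr_gt0// mulr_gt0.
rewrite le_eqVlt; apply/orP; left; apply/eqP; field.
by rewrite !gt_eqF.
Qed.
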